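(* All the squares of the following diagram of symmetric differential graded operads commute: $$\begin{array}{ccccc} \mathrm{Zin}&\leftarrow&\mathrm{Dend}&\leftarrow&\mathrm{PreLie}\\ \uparrow&&\uparrow&&\uparrow\\ \Pi&\leftarrow&K&\leftarrow&\Lambda\\ \uparrow&&\uparrow&&\uparrow\\ \mathrm{Com}&\leftarrow&\mathrm{As}&\leftarrow&\mathrm{Lie}\\ \uparrow&&\uparrow&&\uparrow\\ \mathrm{Pasc}&\leftarrow&\mathrm{Trias}&\leftarrow&\amalg\\ \uparrow&&\uparrow&&\uparrow\\ \mathrm{Perm}&\leftarrow&\mathrm{Dias}&\leftarrow&\mathrm{Leib} \end{array}$$ where the operads and the morphisms are those described in the context.
   Context: All operads are symmetric operads in complexes of $\mathbb{Z}$-modules; labels are renumbered in the standard way in partial compositions, and permutations act by relabelling; $\tau$ is the relabelling by $3\mapsto2\mapsto1\mapsto3$. For a binary generator written $1*2$, $2*1$ denotes its image under the transposition. The operads of rows 1, 3, 5 have zero differential. Row 2 (generators, relations, differential). - $\Pi$: generators $1\otimes2$, $2\otimes 1$ (dim. $0$), $1\wedge2=-2\wedge1$ (dim. $1$); relations $(1\otimes 2)\circ_1 (1\otimes 2)=(1\otimes 2)\circ_2 (1\otimes 2)+(1\otimes 2)\circ_2 (2\otimes 1)$; $(1\wedge 2)\circ_2(1\otimes 2)=(1\otimes 2)\circ_1(1\wedge2)=\tau((1\wedge 2)\circ_1(2\otimes 1))$; $(2\wedge 1)\circ_1(1\wedge2)=(1\wedge 2)\circ_2 (1\wedge2)$;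 $d(1\otimes2)=1\wedge 2$, $d(1\wedge2)=0$. - $K$: the symmetric operad associated to the non-symmetric operad $K'$ with generators $(1<2),(1>2)$ (dim. $0$), $(1|2)$ (dim. $1$); relations $(1 > 2)\circ_2 (1 < 2)=(1 < 2)\circ_1 (1 > 2)$; $(1 > 2)\circ_2 (1 > 2)=(1 > 2)\circ_1 (1 > 2)+(1 > 2)\circ_1 (1 < 2)$; $(1 < 2)\circ_1 (1 < 2)=(1 < 2)\circ_2 (1 < 2)+(1 < 2)\circ_2 (1 > 2)$; $(1 > 2)\circ_2 (1 | 2)= (1 | 2)\circ_1 (1 > 2)$; $(1 < 2)\circ_1 (1 | 2) = (1 | 2)\circ_2 (1 < 2)$; $(1 | 2)\circ_1 (1 < 2)=(1 | 2)\circ_2 (1 > 2)$; $(1 | 2)\circ_1 (1 | 2)=-(1 | 2)\circ_2 (1 | 2)$; $d(1<2)=-d(1>2)=(1|2)$, $d(1|2)=0$. - $\Lambda$: generators $a=1\curvearrowleft2$, $2\curvearrowleft1$ (dim. $0$), $b=[1,2]=[2,1]$ (dim. $1$); relations: $a\circ_1a-a\circ_2a$ is invariant under exchange of $2$ and $3$; $a\circ_1 b=(2\,3)\cdot(b\circ_1 a)+b\circ_2a$ (that is, $[1,2]\curvearrowleft 3=[1\curvearrowleft 3,2]+[1,2\curvearrowleft 3]$); $b\circ_1b+\tau(b\circ_1b)+\tau^2(b\circ_1b)=0$; $d(a)=b$, $d(b)=0$. Row 4. - $\mathrm{Pasc}$: generators $e_1,e_2$ (dim. $0$, exchanged by the transposition),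 $e_1\wedge e_2$ (dim. $1$, antisymmetric); relations $e_1 \circ_1 e_1=\tau^2(e_2\circ_1 e_1)$; $e_2 \circ_1 e_1= e_2 \circ_1 e_2$; $e_1\circ_1 e_2=\tau(e_2\circ_1 e_2)$; $e_2\circ_1 (e_1\wedge e_2)=0$; $\tau((e_1\wedge e_2) \circ_1 e_2) = e_1 \circ_1 (e_1\wedge e_2)=-\tau^2((e_1\wedge e_2)\circ_1 e_1)$; $(e_1\wedge e_2)\circ_1 (e_1\wedge e_2)=\tau((e_1\wedge e_2)\circ_1(e_1\wedge e_2))$; $d(e_1\wedge e_2)=e_1-e_2$, $d(e_1)=0$. - $\mathrm{Trias}$: the symmetric operad associated to the non-symmetric operad with generators $1\dashv2,1\vdash2$ (dim. $0$), $1\times2$ (dim. $1$); relations $(1 \dashv 2)\circ_1 (1 \vdash 2)=(1 \vdash 2)\circ_2 (1 \dashv 2)$; $(1 \dashv 2)\circ_2 (1 \dashv 2)=(1 \dashv 2)\circ_2 (1 \vdash 2)=(1 \dashv 2)\circ_1 (1 \dashv 2)$; $(1 \vdash 2)\circ_1 (1 \vdash 2)=(1 \vdash 2)\circ_1 (1 \dashv 2)=(1 \vdash 2)\circ_2 (1 \vdash 2)$; $(1\times 2)\circ_1 (1 \vdash 2)=(1 \vdash 2)\circ_2 (1\times 2)$; $(1\times 2)\circ_2 (1 \dashv 2)=(1 \dashv 2)\circ_1 (1\times 2)$; $(1\times 2)\circ_1 (1 \dashv 2)=(1\times 2)\circ_2 (1 \vdash 2)$; $(1 \vdash 2)\circ_1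 (1\times 2)=0=(1\dashv 2)\circ_2 (1 \times 2)$; $(1\times 2)\circ_1 (1\times 2)=-(1\times 2)\circ_2 (1\times 2)$; $d(1\times2)=1\dashv2-1\vdash2$, $d(1\vdash2)=d(1\dashv2)=0$. - $\amalg$: generators $\langle1,2\rangle,\langle2,1\rangle$ (dim. $0$), $[1,2]=[2,1]$ (dim. $1$); relations $\langle 1,2 \rangle \circ_1 \langle 1,2 \rangle - \tau (\langle 1,2\rangle \circ_1 \langle 2,1 \rangle)+\tau^2 (\langle 2,1 \rangle \circ_1 \langle 2,1 \rangle)=0$; $\tau^2 ([1,2]\circ_1 \langle 1,2 \rangle) +\tau ([1,2]\circ_1 \langle2,1 \rangle)=\langle 1,2 \rangle \circ_1 [1,2]$; $\langle 2,1 \rangle \circ_1 [1,2]= 0$; $[1,2]\circ_1 [1,2]+\tau([1,2]\circ_1 [1,2])+\tau^2([1,2]\circ_1 [1,2])=0$; $d([1,2])=\langle1,2\rangle+\langle2,1\rangle$, $d(\langle1,2\rangle)=0$. Rows 1, 3, 5. $\mathrm{Com},\mathrm{As},\mathrm{Lie}$: commutative associative, associative, Lie algebras. $\mathrm{Zin}$, $\mathrm{Dend}$, $\mathrm{PreLie}$ (Zinbiel, dendriform, pre-Lie algebras) are the quotients of $\Pi$, $K$, $\Lambda$ by the elements of non-zero dimension: one product with $(x\prec y)\prec z=x\prec(y\prec z)+x\prec(z\prec y)$ for $\mathrm{Zin}$; the first three relations of $K$ for $\mathrm{Dend}$; the pre-Lie relation for $\mathrm{PreLie}$. $\mathrm{Perm}$,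 $\mathrm{Dias}$, $\mathrm{Leib}$ (commutative dialgebras, dialgebras, Leibniz algebras) are the suboperads of elements of dimension $0$ of $\mathrm{Pasc}$, $\mathrm{Trias}$, $\amalg$. Vertical morphisms. Row 2 to row 1: quotient maps. Row 5 to row 4: inclusions. Row 3 to row 2: the generator of $\mathrm{Com}$ goes to $1\otimes2+2\otimes1$; that of $\mathrm{As}$ to $(1<2)+(1>2)$; the Lie bracket to $1\curvearrowleft2-2\curvearrowleft1$. Row 4 to row 3: $e_1,e_2\mapsto$ the commutative product, $e_1\wedge e_2\mapsto0$; $1\dashv2,1\vdash2\mapsto$ the associative product, $1\times2\mapsto0$; $\langle1,2\rangle\mapsto$ the Lie bracket, $[1,2]\mapsto0$. Horizontal morphisms. $K\to\Pi$: $(1<2)\mapsto1\otimes2$, $(1>2)\mapsto2\otimes1$, $(1|2)\mapsto1\wedge2$. $\Lambda\to K$: $1\curvearrowleft2\mapsto(1<2)-(2>1)$, $[1,2]\mapsto(1|2)+(2|1)$. $\mathrm{As}\to\mathrm{Com}$ and $\mathrm{Lie}\to\mathrm{As}$: the usual ones. $\mathrm{Trias}\to\mathrm{Pasc}$: $1\dashv2\mapsto e_1$, $1\vdash2\mapsto e_2$, $1\times2\mapsto e_1\wedge e_2$. $\amalg\to\mathrm{Trias}$: $\langle1,2\rangle\mapsto(1\dashv2)-(2\vdash1)$, $[1,2]\mapsto(1\times2)+(2\times1)$. The horizontal morphisms of rows 1 and 5 are induced from those of rows 2 and 4 by passing to the quotient, respectively by restriction. *)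

(* Defs.v *)
From HB Require Import structures.
From mathcomp Require Import all_boot all_order all_algebra all_fingroup.
From mathcomp Require Import generic_quotient boolp zify.

Set Implicit Arguments.
Unset Strict Implicit.
Unset Printing Implicit Defensive.

Import Order.TTheory GRing.Theory Num.Theory.
Local Open Scope ring_scope.

(** Conventions.  Complexes are Z-graded and the differential has degree [-1];
    the component of arity [n] and degree [k] of [P] is [P n k].  Inputs are
    numbered from 0, so that the [i]-th partial composition of the literature
    is the one at the ordinal [i - 1].  The arity and the degree of a partial
    composite are only required to be provably equal to their usual values,
    which avoids transports in the axioms. *)

Definition zodd (k : int) : bool := odd `|k|%N.

Definition ksign (V : zmodType) (k : int) (x : V) : V :=
  if zodd k then - x else x.

Record nsOperad := NsOperad {
  ns_car :> nat -> int -> zmodType;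
  op_id : ns_car 1 0;
  op_comp : forall m n p (k l s : int), p.+1 = (m + n)%N -> s = k + l ->
    'I_m -> ns_car m k -> ns_car n l -> ns_car p s;
  op_d : forall n k, ns_car n k -> ns_car n (k - 1);
  op_compDl : forall m n p k l s (e : p.+1 = (m + n)%N) (f : s = k + l)
      (i : 'I_m) (x x' : ns_car m k) (y : ns_car n l),
    op_comp e f i (x + x') y = op_comp e f i x y + op_comp e f i x' y;
  op_compDr : forall m n p k l s (e : p.+1 = (m + n)%N) (f : s = k + l)
      (i : 'I_m) (x : ns_car m k) (y y' : ns_car n l),
    op_comp e f i x (y + y') = op_comp e f i x y + op_comp e f i x y';
  op_comp_idl : forall n l (e : n.+1 = (1 + n)%N) (f : l = 0 + l)
      (y : ns_car n l),
    op_comp e f ord0 op_id y = y;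
  op_comp_idr : forall m k (e : m.+1 = (m + 1)%N) (f : k = k + 0)
      (i : 'I_m) (x : ns_car m k),
    op_comp e f i x op_id = x;
  op_comp_seq : forall m n p q r u (k l s kl ls t : int)
      (exy : q.+1 = (m + n)%N) (fxy : kl = k + l)
      (eyz : r.+1 = (n + p)%N) (fyz : ls = l + s)
      (exy_z : u.+1 = (q + p)%N) (fxy_z : t = kl + s)
      (ex_yz : u.+1 = (m + r)%N) (fx_yz : t = k + ls)
      (i : 'I_m) (j : 'I_n) (h : 'I_q)
      (x : ns_car m k) (y : ns_car n l) (z : ns_car p s),
    h = (i + j)%N :> nat ->
    op_comp exy_z fxy_z h (op_comp exy fxy i x y) z =
    op_comp ex_yz fx_yz i x (op_comp eyz fyz j y z);
  (* the sign is the Koszul sign of the exchange of y and z *)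
  op_comp_par : forall m n p q r u (k l s kl ks t : int)
      (exy : q.+1 = (m + n)%N) (fxy : kl = k + l)
      (exz : r.+1 = (m + p)%N) (fxz : ks = k + s)
      (exy_z : u.+1 = (q + p)%N) (fxy_z : t = kl + s)
      (exz_y : u.+1 = (r + n)%N) (fxz_y : t = ks + l)
      (i j : 'I_m) (i' : 'I_r) (j' : 'I_q)
      (x : ns_car m k) (y : ns_car n l) (z : ns_car p s),
    (i < j)%N -> i' = i :> nat -> j'.+1 = (j + n)%N ->
    op_comp exz_y fxz_y i' (op_comp exz fxz j x z) y =
    ksign (l * s) (op_comp exy_z fxy_z j' (op_comp exy fxy i x y) z);
  op_dD : forall n k (x y : ns_car n k), op_d (x + y) = op_d x + op_d y;
  op_dd : forall n k (x : ns_car n k), op_d (op_d x) = 0;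
  op_d_comp : forall m n p k l s (e : p.+1 = (m + n)%N) (f : s = k + l)
      (fl : s - 1 = (k - 1) + l) (fr : s - 1 = k + (l - 1))
      (i : 'I_m) (x : ns_car m k) (y : ns_car n l),
    op_d (op_comp e f i x y) =
    op_comp e fl i (op_d x) y + ksign k (op_comp e fr i x (op_d y))
}.

Arguments op_id {_}.
Arguments op_comp {_ m n p k l s}.
Arguments op_d {_ n k}.

(** Label that the input [j <> i] of [x] carries in the partial composite at
    [i] of [x] with an operation of arity [n]. *)
Definition shift_label (i n j : nat) : nat :=
  if (j < i)%N then j else (j + n).-1.

(** [r] is the relabelling of a partial composite at [i] induced by the
    relabelling [s] of its outer factor and the relabelling [t] of its inner
    factor, which determine it. *)
Definition induced_relabelling m n p (i : 'I_m) (s : 'S_m) (t : 'S_n)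
    (r : 'S_p) : Prop :=
  (forall (j : 'I_m) (h : 'I_p), j != i -> h = shift_label i n j :> nat ->
     r h = shift_label (s i) n (s j) :> nat) /\
  (forall (j : 'I_n) (h : 'I_p), h = (i + j)%N :> nat ->
     r h = (s i + t j)%N :> nat).

Section InducedRelabelling.
Local Open Scope nat_scope.

Lemma induced_relabelling_ex m n p (e : p.+1 = (m + n)%N) (i : 'I_m)
    (s : 'S_m) (t : 'S_n) : exists r : 'S_p, induced_relabelling i s t r.
Proof.
have labelP (h : 'I_p) :
    (exists2 j : 'I_m, j != i & h = shift_label i n j :> nat) \/
    exists j : 'I_n, h = i + j :> nat.
  have [hi|hi] := ltnP h i.
    left; exists (Ordinal (ltn_trans hi (ltn_ord i))); last by rewrite /shift_label /= hi.
    by rewrite -val_eqE /=; lia.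
  have [hin|hin] := ltnP h (i + n).
    have K : h - i < n by lia.
    by right; exists (Ordinal K) => /=; lia.
  have K : h.+1 - n < m by have := ltn_ord h; lia.
  left; exists (Ordinal K); first by rewrite -val_eqE /=; lia.
  by rewrite /shift_label /=; case: ifP; lia.
pose Q (h v : 'I_p) :=
  (forall j : 'I_m, j != i -> h = shift_label i n j :> nat ->
     v = shift_label (s i) n (s j) :> nat) /\
  (forall j : 'I_n, h = i + j :> nat -> v = s i + t j :> nat).
have S (a : 'I_m) (j j' : 'I_m) : j != a -> j' != a ->
    shift_label a n j = shift_label a n j' -> j = j'.
  rewrite -!val_eqE /= /shift_label => ja ja' H; apply/val_inj => /=.
  by move: H; do 2 case: ifP => ?; lia.
have S' (a j : 'I_m) (j' : 'I_n) : j != a -> shift_label a n j = a + j' -> False.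
  rewrite -!val_eqE /= /shift_label; have := ltn_ord j'; case: ifP; lia.
have S2 (a j : 'I_m) : j != a -> shift_label a n j < p.
  rewrite -!val_eqE /= /shift_label; have := ltn_ord a; have := ltn_ord j; case: ifP; lia.
have sN j : j != i -> s j != s i by apply: contra_neq => /perm_inj.
have ex h : exists v, Q h v.
  have [[j ji hj]|[j hj]] := labelP h.
    exists (Ordinal (S2 _ _ (sN _ ji))); split=> [j' ji' hj'|j' hj'] /=.
      by rewrite (S i j j' ji ji') // -hj -hj'.
    by case: (S' i j j' ji); rewrite -hj -hj'.
  have K : s i + t j < p by have := ltn_ord (s i); have := ltn_ord (t j); lia.
  exists (Ordinal K); split=> [j' ji' hj'|j' hj'] /=.
    by case: (S' i j' j ji'); rewrite -hj -hj'.
  by have -> : j' = j by apply/val_inj => /=; lia.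
have [f Hf] := choice ex.
have fI : injective f.
  move=> h h' E; apply/val_inj => /=.
  have [[j ji hj]|[j hj]] := labelP h; have [[j' ji' hj']|[j' hj']] := labelP h'.
  - have := (Hf h).1 j ji hj; have := (Hf h').1 j' ji' hj'; rewrite E => -> H.
    by have /perm_inj jj := S _ _ _ (sN _ ji') (sN _ ji) H; rewrite hj hj' jj.
  - have := (Hf h).1 j ji hj; have := (Hf h').2 j' hj'; rewrite E => -> H.
    by case: (S' (s i) (s j) (t j') (sN _ ji)).
  - have := (Hf h).2 j hj; have := (Hf h').1 j' ji' hj'; rewrite E => -> H.
    by case: (S' (s i) (s j') (t j) (sN _ ji')).
  - have := (Hf h).2 j hj; have := (Hf h').2 j' hj'; rewrite E => -> H.
    have /val_inj/perm_inj jj : val (t j') = val (t j) by move=> /=; lia.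
    by rewrite hj hj' jj.
by exists (perm fI); split=> j h; rewrite permE; [apply: (Hf h).1|apply: (Hf h).2].
Qed.

End InducedRelabelling.

(** [op_act s x] is [x] with each label [j] replaced by [s j]; since
    [(s * t)%g j = t (s j)], this is a left action by relabelling. *)
Record symOperad := SymOperad {
  sym_ns :> nsOperad;
  op_act : forall n k, 'S_n -> sym_ns n k -> sym_ns n k;
  op_actD : forall n k (s : 'S_n) (x y : sym_ns n k),
    op_act s (x + y) = op_act s x + op_act s y;
  op_act1 : forall n k (x : sym_ns n k), op_act 1%g x = x;
  op_actM : forall n k (s t : 'S_n) (x : sym_ns n k),
    op_act (s * t)%g x = op_act t (op_act s x);
  op_act_d : forall n k (s : 'S_n) (x : sym_ns n k),
    op_d (op_act s x) = op_act s (op_d x);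
  op_act_comp : forall m n p k l t (e : p.+1 = (m + n)%N) (f : t = k + l)
      (i : 'I_m) (a : 'S_m) (b : 'S_n) (c : 'S_p)
      (x : sym_ns m k) (y : sym_ns n l),
    induced_relabelling i a b c ->
    op_act c (op_comp e f i x y) = op_comp e f (a i) (op_act a x) (op_act b y)
}.

Arguments op_act {_ n k}.

Record nsMorphism (P Q : nsOperad) := NsMorphism {
  mor_fun :> forall n k, P n k -> Q n k;
  morD : forall n k (x y : P n k), mor_fun (x + y) = mor_fun x + mor_fun y;
  mor_id : mor_fun (@op_id P) = op_id;
  mor_comp : forall m n p k l s (e : p.+1 = (m + n)%N) (f : s = k + l)
      (i : 'I_m) (x : P m k) (y : P n l),
    mor_fun (op_comp e f i x y) = op_comp e f i (mor_fun x) (mor_fun y);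
  mor_d : forall n k (x : P n k), mor_fun (op_d x) = op_d (mor_fun x)
}.

Record symMorphism (P Q : symOperad) := SymMorphism {
  sym_mor :> nsMorphism P Q;
  mor_act : forall n k (s : 'S_n) (x : P n k),
    sym_mor n k (op_act s x) = op_act s (sym_mor n k x)
}.

Arguments mor_fun {P Q} _ n k _.

Section Composition.
Variables (P Q R : symOperad) (g : symMorphism Q R) (f : symMorphism P Q).

Definition ns_mcomp : nsMorphism P R.
Proof.
exists (fun n k (x : P n k) => g n k (f n k x)).
- by move=> *; rewrite !morD.
- by rewrite !mor_id.
- by move=> *; rewrite !mor_comp.
- by move=> *; rewrite !mor_d.
Defined.

Definition sym_mcomp : symMorphism P R.
Proof. by exists ns_mcomp => n k s x /=; rewrite !mor_act. Defined.

End Composition.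

Definition eq_mor (P Q : symOperad) (f g : symMorphism P Q) : Prop :=
  forall n k (x : P n k), f n k x = g n k x.

Section ClassicalQuotient.
Variables (T : Type) (E : T -> T -> Prop).
Hypotheses (Er : forall x, E x x) (Es : forall x y, E x y -> E y x).
Hypothesis Et : forall y x z, E x y -> E y z -> E x z.

Definition cq_rel : rel {classic T} := fun x y => `[< E x y >].

Lemma cq_refl : reflexive cq_rel.
Proof. by move=> x; apply/asboolP. Qed.
Lemma cq_sym : symmetric cq_rel.
Proof. by move=> x y; apply/asboolP/asboolP; apply: Es. Qed.
Lemma cq_trans : transitive cq_rel.
Proof.
by move=> y x z /asboolP exy /asboolP eyz; apply/asboolP; apply: Et exy eyz.
Qed.

Definition cq_equiv := EquivRel cq_rel cq_refl cq_sym cq_trans.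
Definition cquot := {eq_quot cq_equiv}%qT.
HB.instance Definition _ := Choice.on cquot.
Definition cpi (x : T) : cquot := \pi_cquot%qT (x : {classic T}).
Definition crepr (u : cquot) : T := repr u.

Lemma crK u : cpi (crepr u) = u. Proof. exact: reprK. Qed.
Lemma cpiE x y : cpi x = cpi y <-> E x y.
Proof.
split; first by move=> /eqmodP /asboolP.
by move=> exy; apply/eqmodP/asboolP.
Qed.
Lemma crepr_pi x : E (crepr (cpi x)) x.
Proof. by apply/cpiE; rewrite crK. Qed.

End ClassicalQuotient.

(** Operations which satisfy the axioms of an operad only up to [pE]. *)
Record preOperad := PreOperad {
  pT : nat -> int -> Type;
  pE : forall n k, pT n k -> pT n k -> Prop;
  pEr : forall n k (x : pT n k), pE x x;
  pEs : forall n k (x y : pT n k), pE x y -> pE y x;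
  pEt : forall n k (y x z : pT n k), pE x y -> pE y z -> pE x z;
  p0 : forall n k, pT n k;
  pN : forall n k, pT n k -> pT n k;
  pD : forall n k, pT n k -> pT n k -> pT n k;
  pid : pT 1 0;
  pcomp : forall m n p (k l s : int), p.+1 = (m + n)%N -> s = k + l ->
    'I_m -> pT m k -> pT n l -> pT p s;
  pd : forall n k, pT n k -> pT n (k - 1);
  pN_E : forall n k (x y : pT n k), pE x y -> pE (pN x) (pN y);
  pD_E : forall n k (x x' y y' : pT n k), pE x x' -> pE y y' ->
    pE (pD x y) (pD x' y');
  pcomp_E : forall m n p k l s (e : p.+1 = (m + n)%N) (f : s = k + l)
      (i : 'I_m) (x x' : pT m k) (y y' : pT n l),
    pE x x' -> pE y y' -> pE (pcomp e f i x y) (pcomp e f i x' y');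
  pd_E : forall n k (x y : pT n k), pE x y -> pE (pd x) (pd y);
  pDA : forall n k (x y z : pT n k), pE (pD x (pD y z)) (pD (pD x y) z);
  pDC : forall n k (x y : pT n k), pE (pD x y) (pD y x);
  pD0 : forall n k (x : pT n k), pE (pD (p0 n k) x) x;
  pDN : forall n k (x : pT n k), pE (pD (pN x) x) (p0 n k);
  pcompDl : forall m n p k l s (e : p.+1 = (m + n)%N) (f : s = k + l)
      (i : 'I_m) (x x' : pT m k) (y : pT n l),
    pE (pcomp e f i (pD x x') y) (pD (pcomp e f i x y) (pcomp e f i x' y));
  pcompDr : forall m n p k l s (e : p.+1 = (m + n)%N) (f : s = k + l)
      (i : 'I_m) (x : pT m k) (y y' : pT n l),
    pE (pcomp e f i x (pD y y')) (pD (pcomp e f i x y) (pcomp e f i x y'));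
  pcomp_idl : forall n l (e : n.+1 = (1 + n)%N) (f : l = 0 + l)
      (y : pT n l),
    pE (pcomp e f ord0 pid y) y;
  pcomp_idr : forall m k (e : m.+1 = (m + 1)%N) (f : k = k + 0)
      (i : 'I_m) (x : pT m k),
    pE (pcomp e f i x pid) x;
  pcomp_seq : forall m n p q r u (k l s kl ls t : int)
      (exy : q.+1 = (m + n)%N) (fxy : kl = k + l)
      (eyz : r.+1 = (n + p)%N) (fyz : ls = l + s)
      (exy_z : u.+1 = (q + p)%N) (fxy_z : t = kl + s)
      (ex_yz : u.+1 = (m + r)%N) (fx_yz : t = k + ls)
      (i : 'I_m) (j : 'I_n) (h : 'I_q)
      (x : pT m k) (y : pT n l) (z : pT p s),
    h = (i + j)%N :> nat ->
    pE (pcomp exy_z fxy_z h (pcomp exy fxy i x y) z)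
       (pcomp ex_yz fx_yz i x (pcomp eyz fyz j y z));
  pcomp_par : forall m n p q r u (k l s kl ks t : int)
      (exy : q.+1 = (m + n)%N) (fxy : kl = k + l)
      (exz : r.+1 = (m + p)%N) (fxz : ks = k + s)
      (exy_z : u.+1 = (q + p)%N) (fxy_z : t = kl + s)
      (exz_y : u.+1 = (r + n)%N) (fxz_y : t = ks + l)
      (i j : 'I_m) (i' : 'I_r) (j' : 'I_q)
      (x : pT m k) (y : pT n l) (z : pT p s),
    (i < j)%N -> i' = i :> nat -> j'.+1 = (j + n)%N ->
    let v := pcomp exy_z fxy_z j' (pcomp exy fxy i x y) z in
    pE (pcomp exz_y fxz_y i' (pcomp exz fxz j x z) y)
       (if zodd (l * s) then pN v else v);
  pdD : forall n k (x y : pT n k), pE (pd (pD x y)) (pD (pd x) (pd y));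
  pdd : forall n k (x : pT n k), pE (pd (pd x)) (p0 n (k - 1 - 1));
  pd_comp : forall m n p k l s (e : p.+1 = (m + n)%N) (f : s = k + l)
      (fl : s - 1 = (k - 1) + l) (fr : s - 1 = k + (l - 1))
      (i : 'I_m) (x : pT m k) (y : pT n l),
    let v := pcomp e fr i x (pd y) in
    pE (pd (pcomp e f i x y))
       (pD (pcomp e fl i (pd x) y) (if zodd k then pN v else v))
}.

Section PreQuotient.
Variable T : preOperad.

Definition pq n k := cquot (@pEr T n k) (@pEs T n k) (@pEt T n k).
HB.instance Definition _ n k := Choice.on (pq n k).
Definition ppi n k (x : pT T n k) : pq n k := cpi _ _ _ x.
Definition prepr n k (u : pq n k) : pT T n k := crepr u.

Lemma prK n k (u : pq n k) : ppi (prepr u) = u. Proof. exact: crK. Qed.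
Lemma ppiE n k (x y : pT T n k) : ppi x = ppi y <-> pE x y.
Proof. exact: cpiE. Qed.
Lemma prepr_pi n k (x : pT T n k) : pE (prepr (ppi x)) x.
Proof. exact: crepr_pi. Qed.
Lemma pqP n k (u : pq n k) : exists x, u = ppi x.
Proof. by exists (prepr u); rewrite prK. Qed.

Definition pq0 n k : pq n k := ppi (p0 T n k).
Definition pqN n k (u : pq n k) : pq n k := ppi (pN (prepr u)).
Definition pqD n k (u v : pq n k) : pq n k := ppi (pD (prepr u) (prepr v)).
Definition pqcomp m n p k l s (e : p.+1 = (m + n)%N) (f : s = k + l)
    (i : 'I_m) (u : pq m k) (v : pq n l) : pq p s :=
  ppi (pcomp e f i (prepr u) (prepr v)).
Definition pqd n k (u : pq n k) : pq n (k - 1) := ppi (pd (prepr u)).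

Lemma pqN_pi n k (x : pT T n k) : pqN (ppi x) = ppi (pN x).
Proof. by apply/ppiE/pN_E/prepr_pi. Qed.
Lemma pqD_pi n k (x y : pT T n k) : pqD (ppi x) (ppi y) = ppi (pD x y).
Proof. by apply/ppiE/pD_E; apply: prepr_pi. Qed.
Lemma pqcomp_pi m n p k l s (e : p.+1 = (m + n)%N) (f : s = k + l)
    (i : 'I_m) (x : pT T m k) (y : pT T n l) :
  pqcomp e f i (ppi x) (ppi y) = ppi (pcomp e f i x y).
Proof. by apply/ppiE/pcomp_E; apply: prepr_pi. Qed.
Lemma pqd_pi n k (x : pT T n k) : pqd (ppi x) = ppi (pd x).
Proof. by apply/ppiE/pd_E/prepr_pi. Qed.

Section Zmod.
Variables (n : nat) (k : int).
Lemma pq_addA : associative (@pqD n k).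
Proof.
move=> u v w; case: (pqP u) (pqP v) (pqP w) => [x ->] [y ->] [z ->].
by rewrite !pqD_pi; apply/ppiE/pDA.
Qed.
Lemma pq_addC : commutative (@pqD n k).
Proof.
move=> u v; case: (pqP u) (pqP v) => [x ->] [y ->].
by rewrite !pqD_pi; apply/ppiE/pDC.
Qed.
Lemma pq_add0 : left_id (pq0 n k) (@pqD n k).
Proof. by move=> u; case: (pqP u) => x ->; rewrite pqD_pi; apply/ppiE/pD0. Qed.
Lemma pq_addN : left_inverse (pq0 n k) (@pqN n k) (@pqD n k).
Proof.
by move=> u; case: (pqP u) => x ->; rewrite pqN_pi pqD_pi; apply/ppiE/pDN.
Qed.

Definition pq_zmod : zmodType :=
  HB.pack (pq n k) (GRing.isZmodule.Build (pq n k) pq_addA pq_addC pq_add0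
    pq_addN).
End Zmod.

Lemma ppiD n k (x y : pT T n k) :
  (ppi x : pq_zmod n k) + (ppi y : pq_zmod n k) = ppi (pD x y).
Proof. exact: pqD_pi. Qed.
Lemma ppiN n k (x : pT T n k) : - (ppi x : pq_zmod n k) = ppi (pN x).
Proof. exact: pqN_pi. Qed.

Definition pq_operad : nsOperad.
Proof.
exists pq_zmod (ppi (pid T)) pqcomp pqd.
- move=> m n p k l s e f i u u' v.
  case: (pqP u) (pqP u') (pqP v) => [x ->] [x' ->] [y ->].
  by rewrite !(ppiD, pqcomp_pi); apply/ppiE/pcompDl.
- move=> m n p k l s e f i u v v'.
  case: (pqP u) (pqP v) (pqP v') => [x ->] [y ->] [y' ->].
  by rewrite !(ppiD, pqcomp_pi); apply/ppiE/pcompDr.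
- move=> n l e f v; case: (pqP v) => y ->.
  by rewrite !pqcomp_pi; apply/ppiE/pcomp_idl.
- move=> n l e f i v; case: (pqP v) => y ->.
  by rewrite !pqcomp_pi; apply/ppiE/pcomp_idr.
- move=> m n p q r u k l s kl ls t exy fxy eyz fyz e1 f1 e2 f2 i j h x y z hij.
  case: (pqP x) (pqP y) (pqP z) => [a ->] [b ->] [c ->].
  by rewrite !pqcomp_pi; apply/ppiE/pcomp_seq.
- move=> m n p q r u k l s kl ks t exy fxy exz fxz e1 f1 e2 f2 i j i' j'.
  move=> x y z ij ii' jj'.
  case: (pqP x) (pqP y) (pqP z) => [a ->] [b ->] [c ->].
  rewrite !pqcomp_pi.
  have := pcomp_par exy fxy exz fxz e1 f1 e2 f2 a b c ij ii' jj'.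
  rewrite /ksign /=; case: ifP => _ H; last by apply/ppiE.
  by rewrite ppiN; apply/ppiE.
- move=> n k u v; case: (pqP u) (pqP v) => [x ->] [y ->].
  by rewrite !(ppiD, pqd_pi); apply/ppiE/pdD.
- by move=> n k u; case: (pqP u) => [x ->]; rewrite !pqd_pi; apply/ppiE/pdd.
- move=> m n p k l s e f fl fr i u v; case: (pqP u) (pqP v) => [x ->] [y ->].
  have := pd_comp e f fl fr i x y; rewrite !(pqcomp_pi, pqd_pi) /ksign /=.
  by case: ifP => _ H; rewrite ?ppiN ppiD; apply/ppiE.
Defined.

End PreQuotient.

Section SymPreQuotient.
Variables (T : preOperad) (pact : forall n k, 'S_n -> pT T n k -> pT T n k).
Hypotheses
  (pact_E : forall n k (s : 'S_n) (x y : pT T n k),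
     pE x y -> pE (pact s x) (pact s y))
  (pactD : forall n k (s : 'S_n) (x y : pT T n k),
     pE (pact s (pD x y)) (pD (pact s x) (pact s y)))
  (pact1 : forall n k (x : pT T n k), pE (pact 1%g x) x)
  (pactM : forall n k (s t : 'S_n) (x : pT T n k),
     pE (pact (s * t)%g x) (pact t (pact s x)))
  (pact_d : forall n k (s : 'S_n) (x : pT T n k),
     pE (pd (pact s x)) (pact s (pd x)))
  (pact_comp : forall m n p k l t (e : p.+1 = (m + n)%N) (f : t = k + l)
     (i : 'I_m) (a : 'S_m) (b : 'S_n) (c : 'S_p) (x : pT T m k) (y : pT T n l),
     induced_relabelling i a b c ->
     pE (pact c (pcomp e f i x y)) (pcomp e f (a i) (pact a x) (pact b y))).

Definition pqact n k (s : 'S_n) (u : pq_operad T n k) : pq_operad T n k :=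
  ppi (pact s (prepr u)).

Lemma pqact_pi n k (s : 'S_n) (x : pT T n k) : pqact s (ppi x) = ppi (pact s x).
Proof. by apply/ppiE/pact_E/prepr_pi. Qed.

Definition pq_symOperad : symOperad.
Proof.
exists (pq_operad T) pqact.
- move=> n k s u v; case: (pqP u) (pqP v) => [x ->] [y ->].
  by rewrite (ppiD x y) !pqact_pi (ppiD (pact s x));  apply/ppiE/pactD.
- by move=> n k u; case: (pqP u) => x ->; rewrite pqact_pi; apply/ppiE/pact1.
- move=> n k s t u; case: (pqP u) => x ->.
  by rewrite !pqact_pi; apply/ppiE/pactM.
- move=> n k s u; case: (pqP u) => x ->; rewrite pqact_pi /=.
  by rewrite !pqd_pi pqact_pi; apply/ppiE/pact_d.
- move=> m n p k l t e f i a b c u v; case: (pqP u) (pqP v) => [x ->] [y ->].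
  move=> H; have -> : op_comp e f i (ppi x : pq_operad T m k) (ppi y) =
    ppi (pcomp e f i x y) by exact: pqcomp_pi.
  by rewrite !pqact_pi [RHS]pqcomp_pi; apply/ppiE/pact_comp.
Defined.

End SymPreQuotient.

Record ns_ideal (P : nsOperad) (I : forall n k, P n k -> Prop) : Prop := {
  id_0 : forall n k, I n k 0;
  id_B : forall n k (x y : P n k), I n k x -> I n k y -> I n k (x - y);
  id_compl : forall m n p k l s (e : p.+1 = (m + n)%N) (f : s = k + l)
      (i : 'I_m) (x : P m k) (y : P n l),
    I m k x -> I p s (op_comp e f i x y);
  id_compr : forall m n p k l s (e : p.+1 = (m + n)%N) (f : s = k + l)
      (i : 'I_m) (x : P m k) (y : P n l),
    I n l y -> I p s (op_comp e f i x y);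
  id_d : forall n k (x : P n k), I n k x -> I n (k - 1) (op_d x)
}.

Record sym_ideal (P : symOperad) (I : forall n k, P n k -> Prop) : Prop := {
  id_ns :> ns_ideal I;
  id_act : forall n k (s : 'S_n) (x : P n k), I n k x -> I n k (op_act s x)
}.

(** A family [R] of relations is read as the family of equations [x = y] for
    [R n k x y]. *)
Definition ns_ideal_gen (P : nsOperad) (R : forall n k, P n k -> P n k -> Prop)
    n k (x : P n k) : Prop :=
  forall I : forall n k, P n k -> Prop, ns_ideal I ->
    (forall n k (y z : P n k), R n k y z -> I n k (y - z)) -> I n k x.

Definition sym_ideal_gen (P : symOperad)
    (R : forall n k, P n k -> P n k -> Prop) n k (x : P n k) : Prop :=
  forall I : forall n k, P n k -> Prop, sym_ideal I ->
    (forall n k (y z : P n k), R n k y z -> I n k (y - z)) -> I n k x.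

Lemma ns_ideal_genP (P : nsOperad) (R : forall n k, P n k -> P n k -> Prop) :
  ns_ideal (ns_ideal_gen R).
Proof.
split.
- by move=> n k I HI _; apply: (id_0 HI).
- move=> n k x y Hx Hy I HI RI.
  by apply: (id_B HI); [apply: Hx | apply: Hy].
- move=> m n p k l s e f i x y Hx I HI RI.
  by apply: (id_compl HI); apply: Hx.
- move=> m n p k l s e f i x y Hy I HI RI.
  by apply: (id_compr HI); apply: Hy.
- by move=> n k x Hx I HI RI; apply: (id_d HI); apply: Hx.
Qed.

Lemma sym_ideal_genP (P : symOperad) (R : forall n k, P n k -> P n k -> Prop) :
  sym_ideal (sym_ideal_gen R).
Proof.
split; first split.
- by move=> n k I HI _; apply: (id_0 HI).
- move=> n k x y Hx Hy I HI RI.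
  by apply: (id_B HI); [apply: Hx | apply: Hy].
- move=> m n p k l s e f i x y Hx I HI RI.
  by apply: (id_compl HI); apply: Hx.
- move=> m n p k l s e f i x y Hy I HI RI.
  by apply: (id_compr HI); apply: Hy.
- by move=> n k x Hx I HI RI; apply: (id_d HI); apply: Hx.
- by move=> n k s x Hx I HI RI; apply: (id_act HI); apply: Hx.
Qed.

Section OperadTheory.
Variable P : nsOperad.

Lemma op_comp0l m n p k l s (e : p.+1 = (m + n)%N) (f : s = k + l)
  (i : 'I_m) (y : P n l) : op_comp e f i (0 : P m k) y = 0.
Proof. by apply: (addrI (op_comp e f i 0 y)); rewrite -op_compDl !addr0. Qed.
Lemma op_comp0r m n p k l s (e : p.+1 = (m + n)%N) (f : s = k + l)
  (i : 'I_m) (x : P m k) : op_comp e f i x (0 : P n l) = 0.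
Proof. by apply: (addrI (op_comp e f i x 0)); rewrite -op_compDr !addr0. Qed.
Lemma op_compBl m n p k l s (e : p.+1 = (m + n)%N) (f : s = k + l)
    (i : 'I_m) (x x' : P m k) (y : P n l) :
  op_comp e f i (x - x') y = op_comp e f i x y - op_comp e f i x' y.
Proof.
by apply: (addIr (op_comp e f i x' y)); rewrite -op_compDl !subrK.
Qed.
Lemma op_compBr m n p k l s (e : p.+1 = (m + n)%N) (f : s = k + l)
    (i : 'I_m) (x : P m k) (y y' : P n l) :
  op_comp e f i x (y - y') = op_comp e f i x y - op_comp e f i x y'.
Proof.
by apply: (addIr (op_comp e f i x y')); rewrite -op_compDr !subrK.
Qed.
Lemma op_d0 n k : op_d (0 : P n k) = 0.
Proof. by apply: (addrI (op_d (0 : P n k))); rewrite -op_dD !addr0. Qed.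
Lemma op_dB n k (x y : P n k) : op_d (x - y) = op_d x - op_d y.
Proof. by apply: (addIr (op_d y)); rewrite -op_dD !subrK. Qed.
Lemma op_d_id : op_d (@op_id P) = 0.
Proof.
have := op_d_comp (erefl : 2 = (1 + 1)%N) (erefl : 0 = 0 + 0 :> int)
  (erefl : 0 - 1 = (0 - 1) + 0 :> int) (erefl : 0 - 1 = 0 + (0 - 1) :> int)
  ord0 (@op_id P) op_id.
rewrite op_comp_idl op_comp_idr /ksign /= op_comp_idl => H.
by apply: (addrI (op_d op_id)); rewrite -H addr0.
Qed.
Lemma ksign0 n k l : ksign k (0 : P n l) = 0.
Proof. by rewrite /ksign; case: ifP => _ //; rewrite oppr0. Qed.

End OperadTheory.

Lemma op_act0 (P : symOperad) n k (s : 'S_n) : op_act s (0 : P n k) = 0.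
Proof.
by apply: (addrI (op_act s (0 : P n k))); rewrite -op_actD !addr0.
Qed.
Lemma op_actB (P : symOperad) n k (s : 'S_n) (x y : P n k) :
  op_act s (x - y) = op_act s x - op_act s y.
Proof. by apply: (addIr (op_act s y)); rewrite -op_actD !subrK. Qed.
Lemma mor0 (P Q : nsOperad) (f : nsMorphism P Q) n k :
  f n k (0 : P n k) = 0.
Proof. by apply: (addrI (f n k 0)); rewrite -morD !addr0. Qed.
Lemma morB (P Q : nsOperad) (f : nsMorphism P Q) n k (x y : P n k) :
  f n k (x - y) = f n k x - f n k y.
Proof. by apply: (addIr (f n k y)); rewrite -morD !subrK. Qed.

Section Quotient.
Variables (P : nsOperad) (I : forall n k, P n k -> Prop) (HI : ns_ideal I).

Lemma id_N n k (x : P n k) : I x -> I (- x).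
Proof. by move=> Hx; rewrite -[- x]add0r; apply: id_B => //; apply: id_0. Qed.
Lemma id_D n k (x y : P n k) : I x -> I y -> I (x + y).
Proof.
by move=> Hx Hy; rewrite -[y]opprK; apply: id_B => //; apply: id_N.
Qed.

Lemma id_eq n k (x y : P n k) : x = y -> I (x - y).
Proof. by move=> ->; rewrite subrr; apply: id_0. Qed.

Definition ideal_preOperad : preOperad.
Proof.
refine (@PreOperad (fun n k => P n k) (fun n k x y => I (x - y)) _ _ _
  (fun n k => 0) (fun n k x => - x) (fun n k x y => x + y) op_id
  (fun m n p k l s e f i x y => op_comp e f i x y) (fun n k x => op_d x)
  _ _ _ _ _ _ _ _ _ _ _ _ _ _ _ _ _).
- by move=> n k x; apply: id_eq.
- by move=> n k x y H; rewrite -opprB; apply: id_N.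
- by move=> n k y x z H K; rewrite -(subrKA y); apply: id_D.
- by move=> n k x y H; rewrite -opprD; apply: id_N.
- by move=> n k x x' y y' H K; rewrite opprD addrACA; apply: id_D.
- move=> m n p k l s e f i x x' y y' H K.
  rewrite -(subrKA (op_comp e f i x' y)) -op_compBl -op_compBr.
  by apply: id_D; [apply: id_compl|apply: id_compr].
- by move=> n k x y H; rewrite -op_dB; apply: id_d.
- by move=> *; apply: id_eq; rewrite addrA.
- by move=> *; apply: id_eq; rewrite addrC.
- by move=> *; apply: id_eq; rewrite add0r.
- by move=> *; apply: id_eq; rewrite addNr.
- by move=> *; apply: id_eq; rewrite op_compDl.
- by move=> *; apply: id_eq; rewrite op_compDr.
- by move=> *; apply: id_eq; rewrite op_comp_idl.
- by move=> *; apply: id_eq; rewrite op_comp_idr.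
- by move=> *; apply: id_eq; apply: op_comp_seq.
- by move=> *; apply: id_eq; apply: op_comp_par.
- by move=> *; apply: id_eq; rewrite op_dD.
- by move=> *; apply: id_eq; rewrite op_dd.
- by move=> *; apply: id_eq; apply: op_d_comp.
Defined.

Definition ns_quot : nsOperad := pq_operad ideal_preOperad.

Definition ns_proj : nsMorphism P ns_quot.
Proof.
exists (fun n k (x : P n k) => (@ppi ideal_preOperad n k x : ns_quot n k)) => //.
- by move=> *; rewrite ppiD.
- by move=> *; rewrite /= pqcomp_pi.
- by move=> *; rewrite /= pqd_pi.
Defined.

Lemma ns_projE n k (x y : P n k) : ns_proj n k x = ns_proj n k y <-> I (x - y).
Proof. exact: (@ppiE ideal_preOperad). Qed.

Lemma ns_projP n k (u : ns_quot n k) : exists x, u = ns_proj n k x.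
Proof. exact: (@pqP ideal_preOperad). Qed.

End Quotient.

Section SymQuotient.
Variables (P : symOperad) (I : forall n k, P n k -> Prop) (HI : sym_ideal I).

Definition sym_quot : symOperad.
Proof.
apply: (@pq_symOperad (ideal_preOperad HI) (fun n k s x => @op_act P n k s x)).
- by move=> n k s x y H /=; rewrite -op_actB; apply: id_act.
- by move=> *; rewrite op_actD; apply: pEr.
- by move=> *; rewrite op_act1; apply: pEr.
- by move=> *; rewrite op_actM; apply: pEr.
- by move=> *; rewrite /= op_act_d subrr; apply: (id_0 HI).
- move=> m n p k l t e f i a b c x y H /=.
  by rewrite (op_act_comp _ _ _ _ H) subrr; apply: (id_0 HI).
Defined.

Definition sym_proj : symMorphism P sym_quot.
Proof.
exists (ns_proj HI : nsMorphism P sym_quot) => n k s x.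
by rewrite /= pqact_pi // => *; rewrite /= -op_actB; apply: id_act.
Defined.

Lemma sym_projE n k (x y : P n k) :
  sym_proj n k x = sym_proj n k y <-> I (x - y).
Proof. exact: ns_projE. Qed.

Lemma sym_projP n k (u : sym_quot n k) : exists x, u = sym_proj n k x.
Proof. exact: (ns_projP u). Qed.

End SymQuotient.

Section Lift.
Variables (P Q : symOperad) (I : forall n k, P n k -> Prop).
Variables (HI : sym_ideal I) (f : symMorphism P Q).
Hypothesis fI : forall n k (x : P n k), I x -> f n k x = 0.

Definition lift_fun n k (u : sym_quot HI n k) : Q n k :=
  f n k (@prepr (ideal_preOperad HI) n k u).

Lemma lift_proj n k (x : P n k) : lift_fun (sym_proj HI n k x) = f n k x.
Proof.
apply/eqP; rewrite -subr_eq0 -morB; apply/eqP/fI.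
exact: (@prepr_pi (ideal_preOperad HI)).
Qed.

Definition ns_lift : nsMorphism (sym_quot HI) Q.
Proof.
exists lift_fun.
- move=> n k u v; case: (sym_projP u) (sym_projP v) => [x ->] [y ->].
  by rewrite -morD !lift_proj morD.
- by rewrite -(mor_id (sym_proj HI)) lift_proj mor_id.
- move=> m n p k l s e g i u v.
  case: (sym_projP u) (sym_projP v) => [x ->] [y ->].
  by rewrite -mor_comp !lift_proj mor_comp.
- move=> n k u; case: (sym_projP u) => [x ->].
  by rewrite -mor_d !lift_proj mor_d.
Defined.

Definition sym_lift : symMorphism (sym_quot HI) Q.
Proof.
exists ns_lift => n k s u; case: (sym_projP u) => [x ->] /=.
by rewrite -mor_act !lift_proj mor_act.
Defined.

Lemma sym_lift_proj n k (x : P n k) : sym_lift n k (sym_proj HI n k x) = f n k x.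
Proof. exact: lift_proj. Qed.

End Lift.

(** The free operad on [G] consists of the formal expressions in the elements
    of [G], two of them being identified when they take the same value in each
    operad, for each interpretation of [G] in it. *)

Inductive ns_term (G : nat -> int -> Type) : nat -> int -> Type :=
| NsGen n k : G n k -> ns_term G n k
| NsZero n k : ns_term G n k
| NsOpp n k : ns_term G n k -> ns_term G n k
| NsAdd n k : ns_term G n k -> ns_term G n k -> ns_term G n k
| NsId : ns_term G 1 0
| NsComp m n p k l s (e : p.+1 = (m + n)%N) (f : s = k + l) (i : 'I_m) :
    ns_term G m k -> ns_term G n l -> ns_term G p s
| NsD n k : ns_term G n k -> ns_term G n (k - 1).

Inductive sym_term (G : nat -> int -> Type) : nat -> int -> Type :=
| SymGen n k : G n k -> sym_term G n k
| SymZero n k : sym_term G n k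
| SymOpp n k : sym_term G n k -> sym_term G n k
| SymAdd n k : sym_term G n k -> sym_term G n k -> sym_term G n k
| SymId : sym_term G 1 0
| SymComp m n p k l s (e : p.+1 = (m + n)%N) (f : s = k + l) (i : 'I_m) :
    sym_term G m k -> sym_term G n l -> sym_term G p s
| SymD n k : sym_term G n k -> sym_term G n (k - 1)
| SymAct n k (s : 'S_n) : sym_term G n k -> sym_term G n k.

Arguments NsZero {G n k}.
Arguments NsId {G}.
Arguments SymZero {G n k}.
Arguments SymId {G}.

Section Free.
Variable G : nat -> int -> Type.

Fixpoint ns_eval (P : nsOperad) (g : forall n k, G n k -> P n k) n k
    (t : ns_term G n k) : P n k :=
  match t with
  | NsGen _ _ x => g _ _ x
  | NsZero _ _ => 0
  | NsOpp _ _ t => - ns_eval g t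
  | NsAdd _ _ t u => ns_eval g t + ns_eval g u
  | NsId => op_id
  | NsComp _ _ _ _ _ _ e f i t u => op_comp e f i (ns_eval g t) (ns_eval g u)
  | NsD _ _ t => op_d (ns_eval g t)
  end.

Fixpoint sym_eval (P : symOperad) (g : forall n k, G n k -> P n k) n k
    (t : sym_term G n k) : P n k :=
  match t with
  | SymGen _ _ x => g _ _ x
  | SymZero _ _ => 0
  | SymOpp _ _ t => - sym_eval g t
  | SymAdd _ _ t u => sym_eval g t + sym_eval g u
  | SymId => op_id
  | SymComp _ _ _ _ _ _ e f i t u =>
      op_comp e f i (sym_eval g t) (sym_eval g u)
  | SymD _ _ t => op_d (sym_eval g t)
  | SymAct _ _ s t => op_act s (sym_eval g t)
  end.

Definition ns_term_eq n k (t u : ns_term G n k) : Prop :=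
  forall (P : nsOperad) (g : forall n k, G n k -> P n k),
    ns_eval g t = ns_eval g u.

Definition sym_term_eq n k (t u : sym_term G n k) : Prop :=
  forall (P : symOperad) (g : forall n k, G n k -> P n k),
    sym_eval g t = sym_eval g u.

Definition ns_term_preOperad : preOperad.
Proof.
refine (@PreOperad (ns_term G) ns_term_eq _ _ _ (fun n k => NsZero)
  (@NsOpp G) (@NsAdd G) NsId (@NsComp G) (@NsD G)
  _ _ _ _ _ _ _ _ _ _ _ _ _ _ _ _ _).
- by move=> n k t P g.
- by move=> n k t u tu P g; rewrite tu.
- by move=> n k u t v tu uv P g; rewrite tu.
- by move=> n k t u tu P g /=; rewrite tu.
- by move=> n k t t' u u' tt' uu' P g /=; rewrite tt' uu'.
- by move=> m n p k l s e f i t t' u u' tt' uu' P g /=; rewrite tt' uu'.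
- by move=> n k t u tu P g /=; rewrite tu.
- by move=> n k t u v P g /=; rewrite addrA.
- by move=> n k t u P g /=; rewrite addrC.
- by move=> n k t P g /=; rewrite add0r.
- by move=> n k t P g /=; rewrite addNr.
- by move=> m n p k l s e f i t t' u P g /=; rewrite op_compDl.
- by move=> m n p k l s e f i t t' u P g /=; rewrite op_compDr.
- by move=> n l e f t P g /=; rewrite op_comp_idl.
- by move=> n l e f i t P g /=; rewrite op_comp_idr.
- by move=> *; move=> P g /=; apply: op_comp_seq.
- move=> m n p q r u k l s kl ks t exy fxy exz fxz e1 f1 e2 f2 i j i' j'.
  move=> x y z ij ii' jj' v P g.
  have := op_comp_par exy fxy exz fxz e1 f1 e2 f2
    (ns_eval g x) (ns_eval g y) (ns_eval g z) ij ii' jj'.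
  by rewrite /v /ksign; case: ifP.
- by move=> n k t u P g /=; rewrite op_dD.
- by move=> n k t P g /=; rewrite op_dd.
- move=> m n p k l s e f fl fr i t u v P g /=.
  by rewrite (op_d_comp _ _ fl fr) /v /ksign; case: ifP.
Defined.

Definition sym_term_preOperad : preOperad.
Proof.
refine (@PreOperad (sym_term G) sym_term_eq _ _ _ (fun n k => SymZero)
  (@SymOpp G) (@SymAdd G) SymId (@SymComp G) (@SymD G)
  _ _ _ _ _ _ _ _ _ _ _ _ _ _ _ _ _).
- by move=> n k t P g.
- by move=> n k t u tu P g; rewrite tu.
- by move=> n k u t v tu uv P g; rewrite tu.
- by move=> n k t u tu P g /=; rewrite tu.
- by move=> n k t t' u u' tt' uu' P g /=; rewrite tt' uu'.
- by move=> m n p k l s e f i t t' u u' tt' uu' P g /=; rewrite tt' uu'.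
- by move=> n k t u tu P g /=; rewrite tu.
- by move=> n k t u v P g /=; rewrite addrA.
- by move=> n k t u P g /=; rewrite addrC.
- by move=> n k t P g /=; rewrite add0r.
- by move=> n k t P g /=; rewrite addNr.
- by move=> m n p k l s e f i t t' u P g /=; rewrite op_compDl.
- by move=> m n p k l s e f i t t' u P g /=; rewrite op_compDr.
- by move=> n l e f t P g /=; rewrite op_comp_idl.
- by move=> n l e f i t P g /=; rewrite op_comp_idr.
- by move=> *; move=> P g /=; apply: op_comp_seq.
- move=> m n p q r u k l s kl ks t exy fxy exz fxz e1 f1 e2 f2 i j i' j'.
  move=> x y z ij ii' jj' v P g.
  have := op_comp_par exy fxy exz fxz e1 f1 e2 f2
    (sym_eval g x) (sym_eval g y) (sym_eval g z) ij ii' jj'.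
  by rewrite /v /ksign; case: ifP.
- by move=> n k t u P g /=; rewrite op_dD.
- by move=> n k t P g /=; rewrite op_dd.
- move=> m n p k l s e f fl fr i t u v P g /=.
  by rewrite (op_d_comp _ _ fl fr) /v /ksign; case: ifP.
Defined.

Definition ns_free : nsOperad := pq_operad ns_term_preOperad.

Definition sym_free : symOperad.
Proof.
apply: (@pq_symOperad sym_term_preOperad (@SymAct G)).
- by move=> n k s t u tu P g /=; rewrite tu.
- by move=> n k s t u P g /=; rewrite op_actD.
- by move=> n k t P g /=; rewrite op_act1.
- by move=> n k s s' t P g /=; rewrite op_actM.
- by move=> n k s t P g /=; rewrite op_act_d.
- move=> m n p k l s e f i a b c t u H P g /=.
  exact: (op_act_comp _ _ _ _ H).
Defined.

Definition ns_free_gen n k (x : G n k) : ns_free n k :=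
  @ppi ns_term_preOperad n k (NsGen x).

Definition sym_free_gen n k (x : G n k) : sym_free n k :=
  @ppi sym_term_preOperad n k (SymGen x).

End Free.

Arguments ns_free_gen {G n k}.
Arguments sym_free_gen {G n k}.

(** Free operads are taken in complexes: the differential of a generator is a
    new element, and its value in an operad given by generators and relations
    is imposed as a relation.  Ideals are stable under the differential. *)
Section Presentations.
Variable G : nat -> int -> Type.

Definition ns_pres (R : forall n k, ns_free G n k -> ns_free G n k -> Prop) :
  nsOperad := ns_quot (ns_ideal_genP R).

Definition sym_pres (R : forall n k, sym_free G n k -> sym_free G n k -> Prop) :
  symOperad := sym_quot (sym_ideal_genP R).

Definition ns_gen R n k (x : G n k) : ns_pres R n k :=
  ns_proj (ns_ideal_genP R) n k (ns_free_gen x).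

Definition sym_gen R n k (x : G n k) : sym_pres R n k :=
  sym_proj (sym_ideal_genP R) n k (sym_free_gen x).

End Presentations.

(** Symmetric operad associated with a non-symmetric operad [P]: the symmetric
    operad freely generated by [P] subject to the structure of [P], i.e. the
    value at [P] of the left adjoint of the forgetful functor. *)
Section Symmetrization.
Variable P : nsOperad.

Let F := sym_free (fun n k => P n k).
Let i n k (x : P n k) : F n k := @sym_free_gen (fun n k => P n k) n k x.

Inductive symmetrization_rel : forall n k, F n k -> F n k -> Prop :=
| sr_add n k (x y : P n k) : symmetrization_rel (i (x + y)) (i x + i y)
| sr_id : symmetrization_rel (i op_id) op_id
| sr_comp m n p k l s (e : p.+1 = (m + n)%N) (f : s = k + l) (j : 'I_m)
    (x : P m k) (y : P n l) :
    symmetrization_rel (i (op_comp e f j x y)) (op_comp e f j (i x) (i y))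
| sr_d n k (x : P n k) : symmetrization_rel (i (op_d x)) (op_d (i x)).

Definition symmetrization : symOperad := sym_pres symmetrization_rel.

Definition symmetrization_unit n k (x : P n k) : symmetrization n k :=
  @sym_gen (fun n k => P n k) symmetrization_rel n k x.

End Symmetrization.

Arguments symmetrization_unit {P n k}.

Lemma ns_free_evalE (G : nat -> int -> Type) n k (t : ns_term G n k) :
  ns_eval (@ns_free_gen G) t = @ppi (ns_term_preOperad G) n k t.
Proof.
elim: n k / t => [n k x|n k|n k t IH|n k t IHt u IHu||
    m n p k l s e f i t IHt u IHu|n k t IH] //=.
- by rewrite IH; exact: (@ppiN (ns_term_preOperad G)).
- by rewrite IHt IHu; exact: (@ppiD (ns_term_preOperad G)).
- by rewrite IHt IHu; exact: (@pqcomp_pi (ns_term_preOperad G)).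
- by rewrite IH; exact: (@pqd_pi (ns_term_preOperad G)).
Qed.

Lemma sym_free_evalE (G : nat -> int -> Type) n k (t : sym_term G n k) :
  sym_eval (@sym_free_gen G) t = @ppi (sym_term_preOperad G) n k t.
Proof.
elim: n k / t => [n k x|n k|n k t IH|n k t IHt u IHu||
    m n p k l s e f i t IHt u IHu|n k t IH|n k s t IH] //=.
- by rewrite IH; exact: (@ppiN (sym_term_preOperad G)).
- by rewrite IHt IHu; exact: (@ppiD (sym_term_preOperad G)).
- by rewrite IHt IHu; exact: (@pqcomp_pi (sym_term_preOperad G)).
- by rewrite IH; exact: (@pqd_pi (sym_term_preOperad G)).
- rewrite IH; apply: (@pqact_pi (sym_term_preOperad G)).
  by move=> n' k' s' t' u tu P g /=; rewrite tu.
Qed.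

Lemma ns_eval_mor (G : nat -> int -> Type) (P Q : nsOperad)
    (f : nsMorphism P Q) (g : forall n k, G n k -> P n k) n k
    (t : ns_term G n k) :
  f n k (ns_eval g t) = ns_eval (fun n k x => f n k (g n k x)) t.
Proof.
elim: n k / t => [n k x|n k|n k t IH|n k t IHt u IHu||
    m n p k l s e h i t IHt u IHu|n k t IH] //=.
- exact: mor0.
- by rewrite -IH -sub0r morB mor0 sub0r.
- by rewrite morD IHt IHu.
- exact: mor_id.
- by rewrite mor_comp IHt IHu.
- by rewrite mor_d IH.
Qed.

Lemma sym_eval_mor (G : nat -> int -> Type) (P Q : symOperad)
    (f : symMorphism P Q) (g : forall n k, G n k -> P n k) n k
    (t : sym_term G n k) :
  f n k (sym_eval g t) = sym_eval (fun n k x => f n k (g n k x)) t.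
Proof.
elim: n k / t => [n k x|n k|n k t IH|n k t IHt u IHu||
    m n p k l s e h i t IHt u IHu|n k t IH|n k s t IH] //=.
- exact: mor0.
- by rewrite -IH -sub0r morB mor0 sub0r.
- by rewrite morD IHt IHu.
- exact: mor_id.
- by rewrite mor_comp IHt IHu.
- by rewrite mor_d IH.
- by rewrite mor_act IH.
Qed.

Lemma ns_presP (G : nat -> int -> Type)
    (R : forall n k, ns_free G n k -> ns_free G n k -> Prop) n k
    (u : ns_pres R n k) : exists t, u = ns_eval (@ns_gen G R) t.
Proof.
have [v ->] := ns_projP u; have [t ->] := pqP v; exists t.
by rewrite -ns_eval_mor ns_free_evalE.
Qed.

Lemma sym_presP (G : nat -> int -> Type)
    (R : forall n k, sym_free G n k -> sym_free G n k -> Prop) n k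
    (u : sym_pres R n k) : exists t, u = sym_eval (@sym_gen G R) t.
Proof.
have [v ->] := sym_projP u; have [t ->] := pqP v; exists t.
by rewrite -sym_eval_mor sym_free_evalE.
Qed.

Lemma ns_pres_rel (G : nat -> int -> Type)
    (R : forall n k, ns_free G n k -> ns_free G n k -> Prop) n k
    (x y : ns_free G n k) : R n k x y ->
  ns_proj (ns_ideal_genP R) n k x = ns_proj (ns_ideal_genP R) n k y.
Proof. by move=> xy; apply/ns_projE => I HI; apply. Qed.

Lemma sym_pres_rel (G : nat -> int -> Type)
    (R : forall n k, sym_free G n k -> sym_free G n k -> Prop) n k
    (x y : sym_free G n k) : R n k x y ->
  sym_proj (sym_ideal_genP R) n k x = sym_proj (sym_ideal_genP R) n k y.
Proof. by move=> xy; apply/sym_projE => I HI; apply. Qed.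

Section Quot0.

Definition nonzero_degree_rel (P : symOperad) n k (x y : P n k) : Prop :=
  k != 0 /\ y = 0.

Definition quot0 (P : symOperad) : symOperad :=
  sym_quot (sym_ideal_genP (@nonzero_degree_rel P)).

Definition quot0_proj (P : symOperad) : symMorphism P (quot0 P) :=
  sym_proj (sym_ideal_genP (@nonzero_degree_rel P)).

Lemma quot0_vanish (P Q : symOperad) (f : symMorphism P Q) n k (x : P n k) :
  sym_ideal_gen (@nonzero_degree_rel P) x ->
  sym_mcomp (quot0_proj Q) f n k x = 0.
Proof.
set h := sym_mcomp _ _ => Hx.
apply: (Hx (fun n k x => h n k x = 0)) => {n k x Hx} [|n k x y [k0 ->]].
  split; first split.
  - by move=> n k; rewrite mor0.
  - by move=> n k x y hx hy; rewrite morB hx hy subrr.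
  - by move=> m n p k l s e g i x y hx; rewrite mor_comp hx op_comp0l.
  - by move=> m n p k l s e g i x y hy; rewrite mor_comp hy op_comp0r.
  - by move=> n k x hx; rewrite mor_d hx op_d0.
  - by move=> n k s x hx; rewrite mor_act hx op_act0.
rewrite subr0 /= -(mor0 (quot0_proj Q)); apply/sym_projE => I HI; apply.
by split.
Qed.

Definition quot0_map (P Q : symOperad) (f : symMorphism P Q) :
    symMorphism (quot0 P) (quot0 Q) :=
  sym_lift (sym_ideal_genP (@nonzero_degree_rel P)) (@quot0_vanish P Q f).

End Quot0.

(** In degree [k <> 0] the suboperad of elements of degree zero is reduced to 0.
    Its differential is zero; it is that of [P] under the hypothesis of
    [sub0_incl]. *)
Section Sub0.
Variable P : symOperad.

Definition sub0_pred n k : {pred P n k} :=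
  fun x => (k == 0) || (x == 0).

Lemma sub0_pred_closed n k : zmod_closed (@sub0_pred n k).
Proof.
split; first by rewrite /in_mem /= /sub0_pred eqxx orbT.
move=> x y; rewrite /in_mem /= /sub0_pred; case: eqP => //= _.
by move=> /eqP -> /eqP ->; rewrite subrr.
Qed.

HB.instance Definition _ n k :=
  GRing.isZmodClosed.Build (P n k) (@sub0_pred n k) (@sub0_pred_closed n k).

Definition sub0_car n k := {x : P n k | x \in @sub0_pred n k}.
HB.instance Definition _ n k := Choice.on (sub0_car n k).
HB.instance Definition _ n k := SubType.on (sub0_car n k).
HB.instance Definition _ n k := SubChoice.on (sub0_car n k).
HB.instance Definition _ n k :=
  [SubChoice_isSubZmodule of sub0_car n k by <:].

Lemma sub0_id_subproof : (op_id : P 1 0) \in @sub0_pred 1 0.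
Proof. by []. Qed.

Lemma sub0_comp_subproof m n p k l s (e : p.+1 = (m + n)%N) (f : s = k + l)
    (i : 'I_m) (x : sub0_car m k) (y : sub0_car n l) :
  op_comp e f i (val x) (val y) \in @sub0_pred p s.
Proof.
case: x y => [x hx] [y hy] /=; move: hx hy; rewrite /in_mem /= /sub0_pred.
case: (eqVneq k 0) => [k0 _|_ /= /eqP ->]; last first.
  by rewrite op_comp0l eqxx orbT.
case: (eqVneq l 0) => [l0 _|_ /= /eqP ->]; last first.
  by rewrite op_comp0r eqxx orbT.
by apply/orP; left; rewrite [X in X == _]f k0 l0.
Qed.

Lemma sub0_act_subproof n k (s : 'S_n) (x : sub0_car n k) :
  op_act s (val x) \in @sub0_pred n k.
Proof.
case: x => [x hx] /=; move: hx; rewrite /in_mem /= /sub0_pred.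
by case: (eqVneq k 0) => //= _ /eqP ->; rewrite op_act0.
Qed.

Definition sub0_id : sub0_car 1 0 := 
  exist (fun x => x \in @sub0_pred 1 0) op_id sub0_id_subproof.
Definition sub0_comp m n p k l s (e : p.+1 = (m + n)%N) (f : s = k + l)
    (i : 'I_m) (x : sub0_car m k) (y : sub0_car n l) : sub0_car p s :=
  exist (fun x => x \in @sub0_pred p s) _ (sub0_comp_subproof e f i x y).
Definition sub0_act n k (s : 'S_n) (x : sub0_car n k) : sub0_car n k :=
  exist (fun x => x \in @sub0_pred n k) _ (sub0_act_subproof s x).

Definition sub0_ns : nsOperad.
Proof.
exists (fun n k => sub0_car n k : zmodType) sub0_id sub0_comp
  (fun n k _ => 0).
- by move=> m n p k l s e f i x x' y; apply/val_inj; rewrite /= op_compDl.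
- by move=> m n p k l s e f i x x' y; apply/val_inj; rewrite /= op_compDr.
- by move=> n l e f y; apply/val_inj; rewrite /= op_comp_idl.
- by move=> n l e f i y; apply/val_inj; rewrite /= op_comp_idr.
- by move=> *; apply/val_inj; apply: op_comp_seq.
- move=> m n p q r u k l s kl ks t exy fxy exz fxz e1 f1 e2 f2 i j i' j'.
  move=> x y z ij ii' jj'; apply/val_inj.
  have /= -> := op_comp_par exy fxy exz fxz e1 f1 e2 f2
    (val x) (val y) (val z) ij ii' jj'.
  by rewrite /ksign; case: ifP.
- by move=> *; rewrite addr0.
- by [].
- move=> m n p k l s e f fl fr i x y; apply/val_inj.
  by rewrite /ksign; case: ifP => _; rewrite /= op_comp0l op_comp0r ?oppr0 addr0.
Defined.

Definition sub0 : symOperad.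
Proof.
exists sub0_ns sub0_act.
- by move=> n k s x y; apply/val_inj; rewrite /= op_actD.
- by move=> n k x; apply/val_inj; rewrite /= op_act1.
- by move=> n k s t x; apply/val_inj; rewrite /= op_actM.
- by move=> n k s x; apply/val_inj; rewrite /= op_act0.
- move=> m n p k l t e f i a b c x y H; apply/val_inj => /=.
  exact: op_act_comp.
Defined.

Definition degree0_cycles : Prop := forall n (x : P n 0), op_d x = 0.

Definition sub0_incl (H : degree0_cycles) : symMorphism sub0 P.
Proof.
unshelve eexists; first exists (fun n k (x : sub0 n k) => val x) => //.
- move=> n k [x hx] /=; move: hx; rewrite /in_mem /= /sub0_pred.
  case: eqVneq x => [-> x _|_ x /= /eqP ->]; last by rewrite op_d0.
  by rewrite H.
- by [].
Defined.

End Sub0.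

Section Sub0Map.
Variables (P Q : symOperad) (f : symMorphism P Q).

Lemma sub0_map_subproof n k (x : sub0 P n k) :
  f n k (val x) \in @sub0_pred Q n k.
Proof.
case: x => [x hx] /=; move: hx; rewrite /in_mem /= /sub0_pred.
by case: (k == 0) => //= /eqP ->; rewrite mor0.
Qed.

Definition sub0_map : symMorphism (sub0 P) (sub0 Q).
Proof.
unshelve eexists.
  exists (fun n k (x : sub0 P n k) =>
    exist (fun x => x \in @sub0_pred Q n k) (f n k (val x))
      (sub0_map_subproof x) : sub0 Q n k) => //.
  - by move=> n k x y; apply/val_inj; rewrite /= morD.
  - by apply/val_inj; rewrite /= mor_id.
  - by move=> m n p k l s e g i x y; apply/val_inj; rewrite /= mor_comp.
  - by move=> n k x; apply/val_inj; rewrite /= mor0.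
by move=> n k s x; apply/val_inj; rewrite /= mor_act.
Defined.

End Sub0Map.

Definition good_degree (P : nsOperad) n k (x : P n k) : Prop :=
  (k < 0 -> x = 0) /\ (k = 0 -> op_d x = 0).

Section GoodDegree.
Variable P : nsOperad.

Lemma good0 n k : good_degree (0 : P n k).
Proof. by split=> // _; rewrite op_d0. Qed.
Lemma goodN n k (x : P n k) : good_degree x -> good_degree (- x).
Proof.
move=> [h0 h1]; split=> hk; first by rewrite h0 ?oppr0.
by rewrite -sub0r op_dB op_d0 h1 ?subrr.
Qed.
Lemma goodD n k (x y : P n k) :
  good_degree x -> good_degree y -> good_degree (x + y).
Proof.
move=> [h0 h1] [h2 h3]; split=> hk; first by rewrite h0 ?h2 ?addr0.
by rewrite op_dD h1 ?h3 ?addr0.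
Qed.
Lemma good_id : good_degree (@op_id P).
Proof. by split=> // _; rewrite op_d_id. Qed.
Lemma good_comp m n p k l s (e : p.+1 = (m + n)%N) (f : s = k + l)
    (i : 'I_m) (x : P m k) (y : P n l) :
  good_degree x -> good_degree y -> good_degree (op_comp e f i x y).
Proof.
move=> [hx0 hx1] [hy0 hy1].
have [k0|k0] := ltP k 0.
  by rewrite hx0 // op_comp0l; apply: good0.
have [l0|l0] := ltP l 0.
  by rewrite hy0 // op_comp0r; apply: good0.
have s0 : 0 <= s by rewrite [X in _ <= X]f addr_ge0.
split=> hs; first by move: hs; rewrite ltNge s0.
have /andP[/eqP k1 /eqP l1] : (k == 0) && (l == 0).
  by rewrite -paddr_eq0 // -f hs.
have fl : s - 1 = (k - 1) + l by rewrite f addrAC.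
have fr : s - 1 = k + (l - 1) by rewrite f addrA.
rewrite (op_d_comp _ _ fl fr) hx1 // hy1 // op_comp0l op_comp0r.
by rewrite ksign0 addr0.
Qed.
Lemma good_d n k (x : P n k) : good_degree x -> good_degree (op_d x).
Proof.
move=> [h0 h1]; split=> hk; last by rewrite op_dd.
have [k0|k0] := ltP k 0; first by rewrite h0 // op_d0.
apply: h1; apply/eqP; rewrite eq_le k0 andbT.
by move: hk; rewrite subr_lt0 -[1]add0r ltzD1.
Qed.

End GoodDegree.

Lemma good_act (P : symOperad) n k (s : 'S_n) (x : P n k) :
  good_degree x -> good_degree (op_act s x).
Proof.
move=> [h0 h1]; split=> hk; first by rewrite h0 // op_act0.
by rewrite op_act_d h1 // op_act0.
Qed.

Lemma ns_eval_good (G : nat -> int -> Type) (P : nsOperad)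
    (g : forall n k, G n k -> P n k) :
  (forall n k (x : G n k), good_degree (g n k x)) ->
  forall n k (t : ns_term G n k), good_degree (ns_eval g t).
Proof.
move=> H n k t.
elim: n k / t => [n k x|n k|n k t IH|n k t IHt u IHu||
    m n p k l s e f i t IHt u IHu|n k t IH] /=.
- exact: H.
- exact: good0.
- exact: goodN.
- exact: goodD.
- exact: good_id.
- exact: good_comp.
- exact: good_d.
Qed.

Lemma sym_eval_good (G : nat -> int -> Type) (P : symOperad)
    (g : forall n k, G n k -> P n k) :
  (forall n k (x : G n k), good_degree (g n k x)) ->
  forall n k (t : sym_term G n k), good_degree (sym_eval g t).
Proof.
move=> H n k t.
elim: n k / t => [n k x|n k|n k t IH|n k t IHt u IHu||
    m n p k l s e f i t IHt u IHu|n k t IH|n k s t IH] /=.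
- exact: H.
- exact: good0.
- exact: goodN.
- exact: goodD.
- exact: good_id.
- exact: good_comp.
- exact: good_d.
- exact: good_act.
Qed.

Lemma ns_pres_good (G : nat -> int -> Type)
    (R : forall n k, ns_free G n k -> ns_free G n k -> Prop) :
  (forall n k (x : G n k), good_degree (ns_gen R x)) ->
  forall n k (u : ns_pres R n k), good_degree u.
Proof.
by move=> H n k u; have [t ->] := ns_presP u; apply: ns_eval_good.
Qed.

Lemma sym_pres_good (G : nat -> int -> Type)
    (R : forall n k, sym_free G n k -> sym_free G n k -> Prop) :
  (forall n k (x : G n k), good_degree (sym_gen R x)) ->
  forall n k (u : sym_pres R n k), good_degree u.
Proof.
by move=> H n k u; have [t ->] := sym_presP u; apply: sym_eval_good.
Qed.

Lemma symmetrization_d (P : nsOperad) n k (x : P n k) :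
  symmetrization_unit (op_d x) = op_d (symmetrization_unit x).
Proof. by rewrite -[RHS]mor_d; apply: sym_pres_rel; constructor. Qed.

Lemma symmetrization0 (P : nsOperad) n k :
  symmetrization_unit (0 : P n k) = 0.
Proof.
apply: (addrI (symmetrization_unit (0 : P n k))).
rewrite addr0 -[RHS](congr1 symmetrization_unit (addr0 0)) -[LHS]morD.
by apply/esym/sym_pres_rel; constructor.
Qed.

Lemma symmetrization_good (P : nsOperad) :
  (forall n k (x : P n k), good_degree x) ->
  forall n k (u : symmetrization P n k), good_degree u.
Proof.
move=> H; apply: sym_pres_good => n k x; have [h0 h1] := H n k x.
split=> hk; first by rewrite h0 //; apply: symmetrization0.
by rewrite -symmetrization_d h1 //; apply: symmetrization0.
Qed.

Definition swap12 : 'S_2 := tperm ord0 ord_max.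
Definition swap23 : 'S_3 := tperm (inord 1) (inord 2).
(** With labels numbered from 1: 3 -> 2 -> 1 -> 3. *)
Definition tau3 : 'S_3 := perm (@ord_pred_inj 3).

Definition opp2 (P : symOperad) k (x : P 2 k) : P 2 k := op_act swap12 x.
Definition tau (P : symOperad) k (x : P 3 k) : P 3 k := op_act tau3 x.
Definition exch23 (P : symOperad) k (x : P 3 k) : P 3 k := op_act swap23 x.

Definition comp1 (P : nsOperad) k l (x : P 2 k) (y : P 2 l) : P 3 (k + l) :=
  @op_comp P 2 2 3 k l (k + l) erefl erefl ord0 x y.
Definition comp2 (P : nsOperad) k l (x : P 2 k) (y : P 2 l) : P 3 (k + l) :=
  @op_comp P 2 2 3 k l (k + l) erefl erefl ord_max x y.

Notation "x \o1 y" := (comp1 x y) (at level 40, left associativity).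
Notation "x \o2 y" := (comp2 x y) (at level 40, left associativity).

(** The differential raises the dimension in [Pi], [K] and [Lambda] and lowers
    it in [Pasc], [Trias] and [Amalg].  The elements of dimension 1 of the
    former have degree [-1], those of the latter have degree [1]. *)

Inductive Pi_sort : nat -> int -> Type :=
| Pi_tensor : Pi_sort 2 0
| Pi_wedge : Pi_sort 2 (-1).

Section PiRel.
Let t : sym_free Pi_sort 2 0 := sym_free_gen Pi_tensor.
Let w : sym_free Pi_sort 2 (-1) := sym_free_gen Pi_wedge.

Inductive Pi_rel :
    forall n k, sym_free Pi_sort n k -> sym_free Pi_sort n k -> Prop :=
| Pi_wedge_anti : Pi_rel w (- opp2 w)
| Pi_zinbiel : Pi_rel (t \o1 t) (t \o2 t + t \o2 opp2 t)
| Pi_mixed1 : Pi_rel (w \o2 t) (t \o1 w)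
| Pi_mixed2 : Pi_rel (t \o1 w) (tau (w \o1 opp2 t))
| Pi_wedge_assoc : Pi_rel (opp2 w \o1 w) (w \o2 w)
| Pi_d_tensor : Pi_rel (op_d t) w
| Pi_d_wedge : Pi_rel (op_d w) 0.
End PiRel.

Definition Pi : symOperad := sym_pres Pi_rel.

Inductive K_sort : nat -> int -> Type :=
| K_lt : K_sort 2 0
| K_gt : K_sort 2 0
| K_bar : K_sort 2 (-1).

Section KRel.
Let l : ns_free K_sort 2 0 := ns_free_gen K_lt.
Let g : ns_free K_sort 2 0 := ns_free_gen K_gt.
Let b : ns_free K_sort 2 (-1) := ns_free_gen K_bar.

Inductive K_rel :
    forall n k, ns_free K_sort n k -> ns_free K_sort n k -> Prop :=
| K_dend1 : K_rel (g \o2 l) (l \o1 g)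
| K_dend2 : K_rel (g \o2 g) (g \o1 g + g \o1 l)
| K_dend3 : K_rel (l \o1 l) (l \o2 l + l \o2 g)
| K_mixed1 : K_rel (g \o2 b) (b \o1 g)
| K_mixed2 : K_rel (l \o1 b) (b \o2 l)
| K_mixed3 : K_rel (b \o1 l) (b \o2 g)
| K_bar_assoc : K_rel (b \o1 b) (- (b \o2 b))
| K_d_lt : K_rel (op_d l) b
| K_d_gt : K_rel (- op_d g) b
| K_d_bar : K_rel (op_d b) 0.
End KRel.

Definition K_ns : nsOperad := ns_pres K_rel.
Definition K : symOperad := symmetrization K_ns.

Inductive Lambda_sort : nat -> int -> Type :=
| Lambda_pre : Lambda_sort 2 0
| Lambda_bracket : Lambda_sort 2 (-1).

Section LambdaRel.
Let a : sym_free Lambda_sort 2 0 := sym_free_gen Lambda_pre.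
Let b : sym_free Lambda_sort 2 (-1) := sym_free_gen Lambda_bracket.

Inductive Lambda_rel :
    forall n k, sym_free Lambda_sort n k -> sym_free Lambda_sort n k -> Prop :=
| Lambda_bracket_sym : Lambda_rel b (opp2 b)
| Lambda_prelie :
    Lambda_rel (exch23 (a \o1 a - a \o2 a)) (a \o1 a - a \o2 a)
| Lambda_leibniz : Lambda_rel (a \o1 b) (exch23 (b \o1 a) + b \o2 a)
| Lambda_jacobi :
    Lambda_rel (b \o1 b + tau (b \o1 b) + tau (tau (b \o1 b))) 0
| Lambda_d_pre : Lambda_rel (op_d a) b
| Lambda_d_bracket : Lambda_rel (op_d b) 0.
End LambdaRel.

Definition Lambda : symOperad := sym_pres Lambda_rel.

Inductive Pasc_sort : nat -> int -> Type :=
| Pasc_e1 : Pasc_sort 2 0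
| Pasc_e2 : Pasc_sort 2 0
| Pasc_e12 : Pasc_sort 2 1.

Section PascRel.
Let e1 : sym_free Pasc_sort 2 0 := sym_free_gen Pasc_e1.
Let e2 : sym_free Pasc_sort 2 0 := sym_free_gen Pasc_e2.
Let w : sym_free Pasc_sort 2 1 := sym_free_gen Pasc_e12.

Inductive Pasc_rel :
    forall n k, sym_free Pasc_sort n k -> sym_free Pasc_sort n k -> Prop :=
| Pasc_exchange : Pasc_rel (opp2 e1) e2
| Pasc_anti : Pasc_rel (opp2 w) (- w)
| Pasc_perm1 : Pasc_rel (e1 \o1 e1) (tau (tau (e2 \o1 e1)))
| Pasc_perm2 : Pasc_rel (e2 \o1 e1) (e2 \o1 e2)
| Pasc_perm3 : Pasc_rel (e1 \o1 e2) (tau (e2 \o1 e2))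
| Pasc_mixed1 : Pasc_rel (e2 \o1 w) 0
| Pasc_mixed2 : Pasc_rel (tau (w \o1 e2)) (e1 \o1 w)
| Pasc_mixed3 : Pasc_rel (e1 \o1 w) (- tau (tau (w \o1 e1)))
| Pasc_wedge_assoc : Pasc_rel (w \o1 w) (tau (w \o1 w))
| Pasc_d_e12 : Pasc_rel (op_d w) (e1 - e2)
| Pasc_d_e1 : Pasc_rel (op_d e1) 0.
End PascRel.

Definition Pasc : symOperad := sym_pres Pasc_rel.

Inductive Trias_sort : nat -> int -> Type :=
| Trias_left : Trias_sort 2 0
| Trias_right : Trias_sort 2 0
| Trias_times : Trias_sort 2 1.

Section TriasRel.
(* [l] is "dashv", [r] is "vdash" and [x] is the product of dimension 1 *)
Let l : ns_free Trias_sort 2 0 := ns_free_gen Trias_left.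
Let r : ns_free Trias_sort 2 0 := ns_free_gen Trias_right.
Let x : ns_free Trias_sort 2 1 := ns_free_gen Trias_times.

Inductive Trias_rel :
    forall n k, ns_free Trias_sort n k -> ns_free Trias_sort n k -> Prop :=
| Trias_dias1 : Trias_rel (l \o1 r) (r \o2 l)
| Trias_dias2 : Trias_rel (l \o2 l) (l \o2 r)
| Trias_dias3 : Trias_rel (l \o2 r) (l \o1 l)
| Trias_dias4 : Trias_rel (r \o1 r) (r \o1 l)
| Trias_dias5 : Trias_rel (r \o1 l) (r \o2 r)
| Trias_mixed1 : Trias_rel (x \o1 r) (r \o2 x)
| Trias_mixed2 : Trias_rel (x \o2 l) (l \o1 x)
| Trias_mixed3 : Trias_rel (x \o1 l) (x \o2 r)
| Trias_mixed4 : Trias_rel (r \o1 x) 0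
| Trias_mixed5 : Trias_rel (l \o2 x) 0
| Trias_times_assoc : Trias_rel (x \o1 x) (- (x \o2 x))
| Trias_d_times : Trias_rel (op_d x) (l - r)
| Trias_d_right : Trias_rel (op_d r) 0
| Trias_d_left : Trias_rel (op_d l) 0.
End TriasRel.

Definition Trias_ns : nsOperad := ns_pres Trias_rel.
Definition Trias : symOperad := symmetrization Trias_ns.

Inductive Amalg_sort : nat -> int -> Type :=
| Amalg_angle : Amalg_sort 2 0
| Amalg_bracket : Amalg_sort 2 1.

Section AmalgRel.
Let a : sym_free Amalg_sort 2 0 := sym_free_gen Amalg_angle.
Let b : sym_free Amalg_sort 2 1 := sym_free_gen Amalg_bracket.

Inductive Amalg_rel :
    forall n k, sym_free Amalg_sort n k -> sym_free Amalg_sort n k -> Prop :=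
| Amalg_bracket_sym : Amalg_rel b (opp2 b)
| Amalg_leibniz :
    Amalg_rel (a \o1 a - tau (a \o1 opp2 a) + tau (tau (opp2 a \o1 opp2 a))) 0
| Amalg_mixed1 :
    Amalg_rel (tau (tau (b \o1 a)) + tau (b \o1 opp2 a)) (a \o1 b)
| Amalg_mixed2 : Amalg_rel (opp2 a \o1 b) 0
| Amalg_jacobi :
    Amalg_rel (b \o1 b + tau (b \o1 b) + tau (tau (b \o1 b))) 0
| Amalg_d_bracket : Amalg_rel (op_d b) (a + opp2 a)
| Amalg_d_angle : Amalg_rel (op_d a) 0.
End AmalgRel.

Definition Amalg : symOperad := sym_pres Amalg_rel.

Inductive binary_sort : nat -> int -> Type :=
| binary_op : binary_sort 2 0.

Section ClassicalRel.
Let m : sym_free binary_sort 2 0 := sym_free_gen binary_op.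

Inductive Com_rel :
    forall n k, sym_free binary_sort n k -> sym_free binary_sort n k -> Prop :=
| Com_comm : Com_rel (opp2 m) m
| Com_assoc : Com_rel (m \o1 m) (m \o2 m)
| Com_d : Com_rel (op_d m) 0.

Inductive As_rel :
    forall n k, sym_free binary_sort n k -> sym_free binary_sort n k -> Prop :=
| As_assoc : As_rel (m \o1 m) (m \o2 m)
| As_d : As_rel (op_d m) 0.

Inductive Lie_rel :
    forall n k, sym_free binary_sort n k -> sym_free binary_sort n k -> Prop :=
| Lie_anti : Lie_rel (opp2 m) (- m)
| Lie_jacobi : Lie_rel (m \o1 m + tau (m \o1 m) + tau (tau (m \o1 m))) 0
| Lie_d : Lie_rel (op_d m) 0.
End ClassicalRel.

Definition Com : symOperad := sym_pres Com_rel.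
Definition As : symOperad := sym_pres As_rel.
Definition Lie : symOperad := sym_pres Lie_rel.

Definition Zin : symOperad := quot0 Pi.
Definition Dend : symOperad := quot0 K.
Definition PreLie : symOperad := quot0 Lambda.

Definition Perm : symOperad := sub0 Pasc.
Definition Dias : symOperad := sub0 Trias.
Definition Leib : symOperad := sub0 Amalg.

Lemma Pasc_cycles : degree0_cycles Pasc.
Proof.
have d1 : op_d (sym_gen Pasc_rel Pasc_e1) = 0.
  rewrite -[LHS]mor_d -(mor0 (sym_proj (sym_ideal_genP Pasc_rel))).
  by apply: sym_pres_rel; constructor.
suff H : forall n k (x : Pasc n k), good_degree x.
  by move=> n x; apply: (H n 0 x).2.
apply: sym_pres_good => n k [] //; split=> // _.
have <- : opp2 (sym_gen Pasc_rel Pasc_e1) = sym_gen Pasc_rel Pasc_e2.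
  by rewrite -[LHS]mor_act; apply: sym_pres_rel; constructor.
by rewrite op_act_d d1 op_act0.
Qed.

Lemma Trias_cycles : degree0_cycles Trias.
Proof.
suff H : forall n k (x : Trias n k), good_degree x.
  by move=> n x; apply: (H n 0 x).2.
apply: symmetrization_good.
apply: ns_pres_good => n k [] //; split=> // _;
  rewrite -[LHS]mor_d -(mor0 (ns_proj (ns_ideal_genP Trias_rel)));
  by apply: ns_pres_rel; constructor.
Qed.

Lemma Amalg_cycles : degree0_cycles Amalg.
Proof.
suff H : forall n k (x : Amalg n k), good_degree x.
  by move=> n x; apply: (H n 0 x).2.
apply: sym_pres_good => n k [] //; split=> // _.
rewrite -[LHS]mor_d -(mor0 (sym_proj (sym_ideal_genP Amalg_rel))).
by apply: sym_pres_rel; constructor.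
Qed.

Definition Perm_Pasc : symMorphism Perm Pasc := sub0_incl Pasc_cycles.
Definition Dias_Trias : symMorphism Dias Trias := sub0_incl Trias_cycles.
Definition Leib_Amalg : symMorphism Leib Amalg := sub0_incl Amalg_cycles.

Definition Pi_Zin : symMorphism Pi Zin := quot0_proj Pi.
Definition K_Dend : symMorphism K Dend := quot0_proj K.
Definition Lambda_PreLie : symMorphism Lambda PreLie := quot0_proj Lambda.

Definition K_gen n k (x : K_sort n k) : K n k :=
  symmetrization_unit (ns_gen K_rel x).
Definition Trias_gen n k (x : Trias_sort n k) : Trias n k :=
  symmetrization_unit (ns_gen Trias_rel x).
Definition Pi_gen := @sym_gen Pi_sort Pi_rel.
Definition Lambda_gen := @sym_gen Lambda_sort Lambda_rel.
Definition Pasc_gen := @sym_gen Pasc_sort Pasc_rel.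
Definition Amalg_gen := @sym_gen Amalg_sort Amalg_rel.
Definition Com_op : Com 2 0 := sym_gen Com_rel binary_op.
Definition As_op : As 2 0 := sym_gen As_rel binary_op.
Definition Lie_op : Lie 2 0 := sym_gen Lie_rel binary_op.

(** Only the morphisms given on generators are data; the other arrows are the
    projections, the inclusions and the morphisms induced by these. *)
Record diagram := Diagram {
  K_Pi : symMorphism K Pi;
  Lambda_K : symMorphism Lambda K;
  As_Com : symMorphism As Com;
  Lie_As : symMorphism Lie As;
  Trias_Pasc : symMorphism Trias Pasc;
  Amalg_Trias : symMorphism Amalg Trias;
  Com_Pi : symMorphism Com Pi;
  As_K : symMorphism As K;
  Lie_Lambda : symMorphism Lie Lambda;
  Pasc_Com : symMorphism Pasc Com;
  Trias_As : symMorphism Trias As;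
  Amalg_Lie : symMorphism Amalg Lie
}.

Definition described (D : diagram) : Prop :=
  [/\ [/\ K_Pi D 2 0 (K_gen K_lt) = Pi_gen Pi_tensor,
          K_Pi D 2 0 (K_gen K_gt) = opp2 (Pi_gen Pi_tensor) &
          K_Pi D 2 (-1) (K_gen K_bar) = Pi_gen Pi_wedge],
      [/\ Lambda_K D 2 0 (Lambda_gen Lambda_pre) =
            K_gen K_lt - opp2 (K_gen K_gt) &
          Lambda_K D 2 (-1) (Lambda_gen Lambda_bracket) =
            K_gen K_bar + opp2 (K_gen K_bar)],
      [/\ As_Com D 2 0 As_op = Com_op &
          Lie_As D 2 0 Lie_op = As_op - opp2 As_op],
      [/\ Trias_Pasc D 2 0 (Trias_gen Trias_left) = Pasc_gen Pasc_e1,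
          Trias_Pasc D 2 0 (Trias_gen Trias_right) = Pasc_gen Pasc_e2 &
          Trias_Pasc D 2 1 (Trias_gen Trias_times) = Pasc_gen Pasc_e12] &
      [/\ Amalg_Trias D 2 0 (Amalg_gen Amalg_angle) =
            Trias_gen Trias_left - opp2 (Trias_gen Trias_right) &
          Amalg_Trias D 2 1 (Amalg_gen Amalg_bracket) =
            Trias_gen Trias_times + opp2 (Trias_gen Trias_times)]] /\
  [/\ [/\ Com_Pi D 2 0 Com_op =
            Pi_gen Pi_tensor + opp2 (Pi_gen Pi_tensor),
          As_K D 2 0 As_op = K_gen K_lt + K_gen K_gt &
          Lie_Lambda D 2 0 Lie_op =
            Lambda_gen Lambda_pre - opp2 (Lambda_gen Lambda_pre)],
      [/\ Pasc_Com D 2 0 (Pasc_gen Pasc_e1) = Com_op,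
          Pasc_Com D 2 0 (Pasc_gen Pasc_e2) = Com_op &
          Pasc_Com D 2 1 (Pasc_gen Pasc_e12) = 0],
      [/\ Trias_As D 2 0 (Trias_gen Trias_left) = As_op,
          Trias_As D 2 0 (Trias_gen Trias_right) = As_op &
          Trias_As D 2 1 (Trias_gen Trias_times) = 0] &
      [/\ Amalg_Lie D 2 0 (Amalg_gen Amalg_angle) = Lie_op &
          Amalg_Lie D 2 1 (Amalg_gen Amalg_bracket) = 0]].

Definition Dend_Zin (D : diagram) : symMorphism Dend Zin :=
  quot0_map (K_Pi D).
Definition PreLie_Dend (D : diagram) : symMorphism PreLie Dend :=
  quot0_map (Lambda_K D).
Definition Dias_Perm (D : diagram) : symMorphism Dias Perm :=
  sub0_map (Trias_Pasc D).
Definition Leib_Dias (D : diagram) : symMorphism Leib Dias :=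
  sub0_map (Amalg_Trias D).

Definition squares_commute (D : diagram) : Prop :=
  [/\ eq_mor (sym_mcomp (Dend_Zin D) K_Dend) (sym_mcomp Pi_Zin (K_Pi D)) &
      eq_mor (sym_mcomp (PreLie_Dend D) Lambda_PreLie)
             (sym_mcomp K_Dend (Lambda_K D))] /\
  [/\ eq_mor (sym_mcomp (K_Pi D) (As_K D)) (sym_mcomp (Com_Pi D) (As_Com D)) &
      eq_mor (sym_mcomp (Lambda_K D) (Lie_Lambda D))
             (sym_mcomp (As_K D) (Lie_As D))] /\
  [/\ eq_mor (sym_mcomp (As_Com D) (Trias_As D))
             (sym_mcomp (Pasc_Com D) (Trias_Pasc D)) &
      eq_mor (sym_mcomp (Lie_As D) (Amalg_Lie D))
             (sym_mcomp (Trias_As D) (Amalg_Trias D))] /\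
  [/\ eq_mor (sym_mcomp (Trias_Pasc D) Dias_Trias)
             (sym_mcomp Perm_Pasc (Dias_Perm D)) &
      eq_mor (sym_mcomp (Amalg_Trias D) Leib_Amalg)
             (sym_mcomp Dias_Trias (Leib_Dias D))].

(* Main.v *)
From mathcomp Require Import all_boot all_order all_algebra all_fingroup.
Require Import Defs.

Set Implicit Arguments.
Unset Strict Implicit.
Unset Printing Implicit Defensive.

Import GRing.Theory Num.Theory.
Local Open Scope ring_scope.

(** An operad presented by generators and relations represents a functor: a
    morphism from it to [Q] is the same thing as a choice of elements of [Q],
    one for each generator, which satisfy the relations.  For an operad which
    is the symmetrization of a presented non-symmetric one this remains true,
    the relations being read in the symmetric operad [Q].  Hence

    - a morphism described by the values of the generators exists as soon as
      these values satisfy the relations of the source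
      ([sym_pres_universal], [symmetrized_pres_universal]);
    - two morphisms agree as soon as they agree on generators
      ([sym_pres_ext], [symmetrized_pres_ext]).

    The existence of the diagram is thus reduced to twelve implications
    [X_structure_of_Y]: certain combinations of elements which satisfy the
    relations of [Y] satisfy those of [X].  For instance the commutator of an
    associative or of a pre-Lie product is a Lie bracket.  Every relation but
    those on the differential involves at most two binary operations.  In arity
    3 the group of relabellings is generated by [tau] and [exch23], and the
    operad axioms turn each composite of two binary operations and their
    opposites into [tau^i exch23^j (x \o1 y)] or [tau^i exch23^j (x \o2 y)].
    Once written so, both sides of a relation become equal as integral linear
    combinations after substitution of the relations of [Y].

    The middle squares commute on generators: the two composites from [Lie] to
    [K] give [l - g^op - l^op + g], those from [Amalg] to [As] give [m - m^op]
    and 0, and the remaining ones are immediate.  The squares of the first and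
    last rows commute by the definition of the induced morphisms. *)

(** * Equality of integral linear combinations *)

(** Formal expressions in an abelian group; [abelian] proves an equality by
    comparing the coefficients of each atom. *)
Inductive zexp :=
| ZVar of nat | ZZero | ZOpp of zexp | ZAdd of zexp & zexp.

Fixpoint zval (V : zmodType) (s : seq V) (e : zexp) : V :=
  match e with
  | ZVar i => s`_i
  | ZZero => 0
  | ZOpp e => - zval s e
  | ZAdd e f => zval s e + zval s f
  end.

Fixpoint zcoef (e : zexp) (i : nat) : int :=
  match e with
  | ZVar j => (i == j)%:Z
  | ZZero => 0
  | ZOpp e => - zcoef e i
  | ZAdd e f => zcoef e i + zcoef f i
  end.

Lemma zvalE (V : zmodType) (s : seq V) e :
  zval s e = \sum_(i < size s) s`_i *~ zcoef e i.
Proof.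
elim: e => [j||e IH|e IHe f IHf] /=.
- have [jlt|jge] := ltnP j (size s); last first.
    rewrite nth_default // big1 // => i _.
    by rewrite ltn_eqF ?(leq_trans (ltn_ord i)).
  rewrite (bigD1 (Ordinal jlt)) //= eqxx big1 ?addr0 // => i.
  by rewrite -val_eqE /= => /negPf ->.
- by rewrite big1.
- by rewrite IH -sumrN; apply: eq_bigr => i _; rewrite mulrNz.
- by rewrite IHe IHf -big_split; apply: eq_bigr => i _; rewrite mulrzDr.
Qed.

Lemma zval_eq (V : zmodType) (s : seq V) e f :
  all (fun i => zcoef e i == zcoef f i) (iota 0 (size s)) ->
  zval s e = zval s f.
Proof.
move=> /allP H; rewrite !zvalE; apply: eq_bigr => i _.
by have /eqP -> := H i ltac:(by rewrite mem_iota ltn_ord).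
Qed.

(* Atoms are compared by unification: the same tree may occur with degrees
   [0 - 1] and [-1 + 0]. *)
Ltac atom_index s x :=
  match s with
  | cons ?y _ => let _ := match goal with _ => unify x y end in constr:(O)
  | cons _ ?s' => let i := atom_index s' x in constr:(S i)
  end.
Ltac add_atoms s t :=
  lazymatch t with
  | ?a + ?b => let s := add_atoms s a in add_atoms s b
  | - ?a => add_atoms s a
  | 0 => s
  | _ => match s with
         | _ => let i := atom_index s t in s
         | _ => constr:(cons t s)
         end
  end.
Ltac reify_zexp s t :=
  lazymatch t with
  | ?a + ?b => let a := reify_zexp s a in let b := reify_zexp s b in
               constr:(ZAdd a b)
  | - ?a => let a := reify_zexp s a in constr:(ZOpp a)
  | 0 => constr:(ZZero)
  | _ => let i := atom_index s t in constr:(ZVar i)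
  end.
Ltac abelian :=
  lazymatch goal with |- @eq ?V ?x ?y =>
    let s := add_atoms (@nil V) x in let s := add_atoms s y in
    let e := reify_zexp s x in let f := reify_zexp s y in
    exact: (@zval_eq _ s e f isT)
  end.

(** * Morphisms and actions *)

Lemma op_actN (P : symOperad) n k (s : 'S_n) (x : P n k) :
  op_act s (- x) = - op_act s x.
Proof. by rewrite -sub0r op_actB op_act0 sub0r. Qed.

Lemma morN (P Q : nsOperad) (f : nsMorphism P Q) n k (x : P n k) :
  f n k (- x) = - f n k x.
Proof. by rewrite -sub0r morB mor0 sub0r. Qed.

Lemma mor_opp2 (P Q : symOperad) (f : symMorphism P Q) k (x : P 2 k) :
  f 2 k (opp2 x) = opp2 (f 2 k x).
Proof. exact: mor_act. Qed.

Lemma op_d_opp2 (P : symOperad) k (x : P 2 k) : op_d (opp2 x) = opp2 (op_d x).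
Proof. exact: op_act_d. Qed.

(** * Trees with two vertices *)

Lemma swap12E (i : 'I_2) : swap12 i = (1 - i)%N :> nat.
Proof.
rewrite /swap12; case: i => [[|[|i]]] hi //.
  by rewrite (_ : Ordinal hi = ord0) ?tpermL //; apply/val_inj.
by rewrite (_ : Ordinal hi = ord_max) ?tpermR //; apply/val_inj.
Qed.

Lemma tau3E (i : 'I_3) : tau3 i = ((i + 2) %% 3)%N :> nat.
Proof. by rewrite permE /= addnS. Qed.

Lemma swap23E (i : 'I_3) :
  swap23 i = (if i == 0 :> nat then 0 else 3 - i)%N :> nat.
Proof.
rewrite /swap23; case: i => [[|[|[|i]]]] hi //=.
- by rewrite tpermD // -val_eqE /= inordK.
- rewrite (_ : Ordinal hi = inord 1) ?tpermL ?inordK //.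
  by apply/val_inj; rewrite /= inordK.
- rewrite (_ : Ordinal hi = inord 2) ?tpermR ?inordK //.
  by apply/val_inj; rewrite /= inordK.
Qed.

Section Trees.
Variable P : symOperad.

Lemma tauK3 k : cancel (fun x : P 3 k => tau (tau x)) (@tau P k).
Proof.
move=> x; rewrite /tau -!op_actM -[RHS]op_act1; congr op_act.
apply/permP => i; apply/val_inj; rewrite !permM perm1 /= !tau3E.
by case: i => [[|[|[|i]]]].
Qed.

Lemma exch23K k : involutive (@exch23 P k).
Proof. by move=> x; rewrite /exch23 -op_actM tperm2 op_act1. Qed.

(** With the two previous lemmas this brings each relabelling of a tree into
    the form [tau^i exch23^j]. *)
Lemma exch23_tau k (x : P 3 k) : exch23 (tau x) = tau (tau (exch23 x)).
Proof.
rewrite /tau /exch23 -!op_actM; congr op_act.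
apply/permP => i; apply/val_inj; rewrite !permM /= !(swap23E, tau3E).
by case: i => [[|[|[|i]]]].
Qed.

Lemma opp2K k : involutive (@opp2 P k).
Proof. by move=> x; rewrite /opp2 -op_actM tperm2 op_act1. Qed.

Let comp k l i (x : P 2 k) (y : P 2 l) : P 3 (k + l) :=
  @op_comp P 2 2 3 k l (k + l) erefl erefl i x y.

Let comp_act k l i (a b : 'S_2) (c : 'S_3) (x : P 2 k) (y : P 2 l) :
  induced_relabelling i a b c ->
  comp (a i) (op_act a x) (op_act b y) = op_act c (comp i x y).
Proof. by move=> H; rewrite /comp (op_act_comp _ _ _ _ H). Qed.

Ltac relabelling :=
  split=> -[[|[|?]] ?] ?; rewrite -?val_eqE //=
    ?(permM, tau3E, swap23E, perm1, swap12E);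
  by [move=> _ -> | move=> ->].

(** The four lemmas below transfer the opposite of a factor to a relabelling of
    the composite.  Taking the opposite of the outer factor moves the inner one
    to the other input. *)
Lemma comp1_opp2r k l (x : P 2 k) (y : P 2 l) :
  x \o1 opp2 y = tau (tau (exch23 (x \o1 y))).
Proof.
have H : induced_relabelling (ord0 : 'I_2) 1%g swap12
  (swap23 * tau3 * tau3)%g
  by relabelling.
have := comp_act x y H.
by rewrite perm1 op_act1 !op_actM.
Qed.

Lemma comp2_opp2r k l (x : P 2 k) (y : P 2 l) :
  x \o2 opp2 y = exch23 (x \o2 y).
Proof.
have H : induced_relabelling (ord_max : 'I_2) 1%g swap12 swap23
  by relabelling.
have := comp_act x y H.
by rewrite perm1 op_act1.
Qed.

Lemma comp1_opp2l k l (x : P 2 k) (y : P 2 l) : opp2 x \o1 y = tau (x \o2 y).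
Proof.
have H : induced_relabelling (ord_max : 'I_2) swap12 (1%g : 'S_2) tau3
  by relabelling.
have := comp_act x y H.
by rewrite tpermR op_act1.
Qed.

Lemma comp2_opp2l k l (x : P 2 k) (y : P 2 l) :
  opp2 x \o2 y = tau (tau (x \o1 y)).
Proof.
have H : induced_relabelling (ord0 : 'I_2) swap12 (1%g : 'S_2) (tau3 * tau3)%g
  by relabelling.
have := comp_act x y H.
by rewrite tpermL op_act1 op_actM.
Qed.

Lemma opp2D k : {morph @opp2 P k : x y / x + y}.
Proof. by move=> x y; apply: op_actD. Qed.
Lemma opp20 k : opp2 (0 : P 2 k) = 0.
Proof. exact: op_act0. Qed.
Lemma opp2N k : {morph @opp2 P k : x / - x}.
Proof. by move=> x; apply: op_actN. Qed.
Lemma tauD k : {morph @tau P k : x y / x + y}.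
Proof. by move=> x y; apply: op_actD. Qed.
Lemma tauN k : {morph @tau P k : x / - x}.
Proof. by move=> x; apply: op_actN. Qed.
Lemma tau0 k : tau (0 : P 3 k) = 0.
Proof. exact: op_act0. Qed.
Lemma exch23D k : {morph @exch23 P k : x y / x + y}.
Proof. by move=> x y; apply: op_actD. Qed.
Lemma exch23N k : {morph @exch23 P k : x / - x}.
Proof. by move=> x; apply: op_actN. Qed.
Lemma exch230 k : exch23 (0 : P 3 k) = 0.
Proof. exact: op_act0. Qed.

Lemma op_compNl m n p k l s (e : p.+1 = (m + n)%N) (f : s = k + l)
    (i : 'I_m) (x : P m k) (y : P n l) :
  op_comp e f i (- x) y = - op_comp e f i x y.
Proof. by rewrite -sub0r op_compBl op_comp0l sub0r. Qed.
Lemma op_compNr m n p k l s (e : p.+1 = (m + n)%N) (f : s = k + l)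
    (i : 'I_m) (x : P m k) (y : P n l) :
  op_comp e f i x (- y) = - op_comp e f i x y.
Proof. by rewrite -sub0r op_compBr op_comp0r sub0r. Qed.

Section Comp.
Variables (k l : int).
Implicit Types (x : P 2 k) (y : P 2 l).
Lemma comp1Dl x x' y : (x + x') \o1 y = x \o1 y + x' \o1 y.
Proof. exact: op_compDl. Qed.
Lemma comp1Dr x y y' : x \o1 (y + y') = x \o1 y + x \o1 y'.
Proof. exact: op_compDr. Qed.
Lemma comp1Nl x y : (- x) \o1 y = - (x \o1 y).
Proof. exact: op_compNl. Qed.
Lemma comp1Nr x y : x \o1 (- y) = - (x \o1 y).
Proof. exact: op_compNr. Qed.
Lemma comp2Dl x x' y : (x + x') \o2 y = x \o2 y + x' \o2 y.
Proof. exact: op_compDl. Qed.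
Lemma comp2Dr x y y' : x \o2 (y + y') = x \o2 y + x \o2 y'.
Proof. exact: op_compDr. Qed.
Lemma comp2Nl x y : (- x) \o2 y = - (x \o2 y).
Proof. exact: op_compNl. Qed.
Lemma comp2Nr x y : x \o2 (- y) = - (x \o2 y).
Proof. exact: op_compNr. Qed.
Lemma comp10l y : (0 : P 2 k) \o1 y = 0.
Proof. exact: op_comp0l. Qed.
Lemma comp10r x : x \o1 (0 : P 2 l) = 0.
Proof. exact: op_comp0r. Qed.
Lemma comp20l y : (0 : P 2 k) \o2 y = 0.
Proof. exact: op_comp0l. Qed.
Lemma comp20r x : x \o2 (0 : P 2 l) = 0.
Proof. exact: op_comp0r. Qed.
End Comp.

(** Expands a linear combination of trees into normal forms
    [tau^i exch23^j (x \o1 y)] and [tau^i exch23^j (x \o2 y)]. *)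
Definition treeE := (comp1_opp2l, comp1_opp2r, comp2_opp2l, comp2_opp2r,
  comp1Dl, comp1Dr, comp1Nl, comp1Nr, comp2Dl, comp2Dr, comp2Nl, comp2Nr,
  (comp10l, comp10r, comp20l, comp20r, opp20),
  opp2K, opp2D, opp2N, tauK3, exch23K, exch23_tau,
  (tauD, tauN, tau0, exch23D, exch23N, exch230)).

End Trees.

(** * Elements satisfying the relations of a presentation *)

(** [X_structure] holds of elements of [P] when they satisfy the relations of
    the operad [X], those on the differential included; it is the property
    which makes the generators of [X] have a unique extension to a morphism from
    [X] to [P].  The relations of a non-symmetric presentation are read in the
    symmetric operad [P]. *)

Record Pi_structure (P : symOperad) (t : P 2 0) (w : P 2 (-1)) : Prop := {
  Pi_eq_anti : w = - opp2 w;
  Pi_eq_zinbiel : t \o1 t = t \o2 t + t \o2 opp2 t;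
  Pi_eq_mixed1 : w \o2 t = t \o1 w;
  Pi_eq_mixed2 : t \o1 w = tau (w \o1 opp2 t);
  Pi_eq_wedge : opp2 w \o1 w = w \o2 w;
  Pi_eq_dt : op_d t = w;
  Pi_eq_dw : op_d w = 0
}.

Record K_structure (P : symOperad) (l g : P 2 0) (b : P 2 (-1)) : Prop := {
  K_eq_dend1 : g \o2 l = l \o1 g;
  K_eq_dend2 : g \o2 g = g \o1 g + g \o1 l;
  K_eq_dend3 : l \o1 l = l \o2 l + l \o2 g;
  K_eq_mixed1 : g \o2 b = b \o1 g;
  K_eq_mixed2 : l \o1 b = b \o2 l;
  K_eq_mixed3 : b \o1 l = b \o2 g;
  K_eq_bar : b \o1 b = - (b \o2 b);
  K_eq_dl : op_d l = b;
  K_eq_dg : - op_d g = b;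
  K_eq_db : op_d b = 0
}.

Record Lambda_structure (P : symOperad) (a : P 2 0) (b : P 2 (-1)) : Prop := {
  Lambda_eq_sym : b = opp2 b;
  Lambda_eq_prelie : exch23 (a \o1 a - a \o2 a) = a \o1 a - a \o2 a;
  Lambda_eq_leibniz : a \o1 b = exch23 (b \o1 a) + b \o2 a;
  Lambda_eq_jacobi : b \o1 b + tau (b \o1 b) + tau (tau (b \o1 b)) = 0;
  Lambda_eq_da : op_d a = b;
  Lambda_eq_db : op_d b = 0
}.

Record Pasc_structure (P : symOperad) (e1 e2 : P 2 0) (w : P 2 1) : Prop := {
  Pasc_eq_exchange : opp2 e1 = e2;
  Pasc_eq_anti : opp2 w = - w;
  Pasc_eq_perm1 : e1 \o1 e1 = tau (tau (e2 \o1 e1));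
  Pasc_eq_perm2 : e2 \o1 e1 = e2 \o1 e2;
  Pasc_eq_perm3 : e1 \o1 e2 = tau (e2 \o1 e2);
  Pasc_eq_mixed1 : e2 \o1 w = 0;
  Pasc_eq_mixed2 : tau (w \o1 e2) = e1 \o1 w;
  Pasc_eq_mixed3 : e1 \o1 w = - tau (tau (w \o1 e1));
  Pasc_eq_wedge : w \o1 w = tau (w \o1 w);
  Pasc_eq_dw : op_d w = e1 - e2;
  Pasc_eq_de1 : op_d e1 = 0
}.

Record Trias_structure (P : symOperad) (l r : P 2 0) (x : P 2 1) : Prop := {
  Trias_eq_dias1 : l \o1 r = r \o2 l;
  Trias_eq_dias2 : l \o2 l = l \o2 r;
  Trias_eq_dias3 : l \o2 r = l \o1 l;
  Trias_eq_dias4 : r \o1 r = r \o1 l;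
  Trias_eq_dias5 : r \o1 l = r \o2 r;
  Trias_eq_mixed1 : x \o1 r = r \o2 x;
  Trias_eq_mixed2 : x \o2 l = l \o1 x;
  Trias_eq_mixed3 : x \o1 l = x \o2 r;
  Trias_eq_mixed4 : r \o1 x = 0;
  Trias_eq_mixed5 : l \o2 x = 0;
  Trias_eq_times : x \o1 x = - (x \o2 x);
  Trias_eq_dx : op_d x = l - r;
  Trias_eq_dr : op_d r = 0;
  Trias_eq_dl : op_d l = 0
}.

Record Amalg_structure (P : symOperad) (a : P 2 0) (b : P 2 1) : Prop := {
  Amalg_eq_sym : b = opp2 b;
  Amalg_eq_leibniz :
    a \o1 a - tau (a \o1 opp2 a) + tau (tau (opp2 a \o1 opp2 a)) = 0;
  Amalg_eq_mixed1 : tau (tau (b \o1 a)) + tau (b \o1 opp2 a) = a \o1 b;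
  Amalg_eq_mixed2 : opp2 a \o1 b = 0;
  Amalg_eq_jacobi : b \o1 b + tau (b \o1 b) + tau (tau (b \o1 b)) = 0;
  Amalg_eq_db : op_d b = a + opp2 a;
  Amalg_eq_da : op_d a = 0
}.

Record Com_structure (P : symOperad) (m : P 2 0) : Prop := {
  Com_eq_comm : opp2 m = m;
  Com_eq_assoc : m \o1 m = m \o2 m;
  Com_eq_d : op_d m = 0
}.

Record As_structure (P : symOperad) (m : P 2 0) : Prop := {
  As_eq_assoc : m \o1 m = m \o2 m;
  As_eq_d : op_d m = 0
}.

Record Lie_structure (P : symOperad) (m : P 2 0) : Prop := {
  Lie_eq_anti : opp2 m = - m;
  Lie_eq_jacobi : m \o1 m + tau (m \o1 m) + tau (tau (m \o1 m)) = 0;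
  Lie_eq_d : op_d m = 0
}.

(** * Structures induced by other structures *)

(* [abelian] must not unfold distinct trees when it compares them. *)
Local Opaque tau exch23 comp1 comp2.

Section Identities.
Variable P : symOperad.

(** [Pi] is the commutative version of [K], in which the second operation is
    the opposite of the first.  The mixed relations of [Pi] say that
    [t \o1 w] and [w \o2 t] are both [exch23 (w \o1 t)]. *)
Lemma K_structure_of_Pi (t : P 2 0) (w : P 2 (-1)) :
  Pi_structure t w -> K_structure t (opp2 t) w.
Proof.
case=> hw ht h1 h2 hww dt dw.
have h1' : t \o1 w = exch23 (w \o1 t) by rewrite h2 !treeE.
have h2' : w \o2 t = exch23 (w \o1 t) by rewrite h1.
have hww' : w \o1 w = - (w \o2 w).
  have hw' : opp2 w = - w by rewrite [in RHS]hw opprK.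
  by rewrite -hww hw' comp1Nl opprK.
split; rewrite ?op_d_opp2 ?treeE ?ht ?h1' ?h2' ?treeE //;
  last by rewrite dt -hw.
abelian.
Qed.

(** Both sides of associativity are the sum of the six relabellings of
    [t \o2 t].  The differential vanishes because [w] is antisymmetric. *)
Lemma Com_structure_of_Pi (t : P 2 0) (w : P 2 (-1)) :
  Pi_structure t w -> Com_structure (t + opp2 t).
Proof.
case=> hw ht _ _ _ dt _; split.
- by rewrite !treeE addrC.
- by rewrite !treeE ht !treeE; abelian.
- by rewrite op_dD op_d_opp2 dt {1}hw addNr.
Qed.

(** The three dendriform relations add up to the associativity of the sum. *)
Lemma As_structure_of_K (l g : P 2 0) (b : P 2 (-1)) :
  K_structure l g b -> As_structure (l + g).
Proof.
case=> h1 h2 h3 _ _ _ _ dl dg _; split.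
- by rewrite !treeE h1 h2 h3; abelian.
- by rewrite op_dD dl -dg addNr.
Qed.

(** The dendriform relations reduce the associator of [l - opp2 g] to
    [u + exch23 u] for a combination [u] of trees, hence the pre-Lie relation.
    An operation of odd degree with [b \o1 b = - (b \o2 b)] behaves as an
    associative product up to suspension, so that its symmetrization is a Lie
    bracket up to suspension. *)
Lemma Lambda_structure_of_K (l g : P 2 0) (b : P 2 (-1)) :
  K_structure l g b -> Lambda_structure (l - opp2 g) (b + opp2 b).
Proof.
case=> h1 h2 h3 m1 m2 m3 hb dl dg db; split.
- by rewrite !treeE addrC.
- by rewrite !treeE h1 h2 h3 !treeE; abelian.
- by rewrite !treeE m1 m2 m3 ?treeE; abelian.
- by rewrite !treeE hb !treeE; abelian.
- by rewrite op_dB op_d_opp2 dl -opp2N dg.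
- by rewrite op_dD op_d_opp2 db /opp2 op_act0 addr0.
Qed.

(** The cyclic sum of Jacobi is the alternating sum of the associator of [a]
    over all relabellings. *)
Lemma Lie_structure_of_Lambda (a : P 2 0) (b : P 2 (-1)) :
  Lambda_structure a b -> Lie_structure (a - opp2 a).
Proof.
case=> hb; rewrite !treeE => /(canRL (addrK _)) ha _ _ da _; split.
- by rewrite !treeE opprB addrC.
- by rewrite !treeE ha !treeE; abelian.
- by rewrite op_dB op_d_opp2 da -hb subrr.
Qed.

(** Since [m] is associative, each of the six relabellings of [m \o1 m] occurs
    twice in the cyclic sum, with opposite signs. *)
Lemma Lie_structure_of_As (m : P 2 0) :
  As_structure m -> Lie_structure (m - opp2 m).
Proof.
case=> hm dm; split.
- by rewrite !treeE opprB addrC.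
- by rewrite !treeE hm; abelian.
- by rewrite op_dB op_d_opp2 dm /opp2 op_act0 subrr.
Qed.

Lemma As_structure_of_Com (m : P 2 0) : Com_structure m -> As_structure m.
Proof. by case. Qed.

(** In arity 3 the nonzero composites are, up to sign, relabellings of
    [e1 \o2 e1], [w \o1 e1] and [w \o1 w], each of which is fixed up to sign by
    some relabellings. *)
Lemma Trias_structure_of_Pasc (e1 e2 : P 2 0) (w : P 2 1) :
  Pasc_structure e1 e2 w -> Trias_structure e1 e2 w.
Proof.
case=> <- hw; rewrite !treeE => hA hB _ h0 h1 h2 hD dw de.
have tauI k : injective (@tau P k).
  by apply: (can_inj (g := fun x => tau (tau x))) => x; rewrite treeE.
have {}hB : exch23 (e1 \o2 e1) = e1 \o2 e1 by apply/esym/tauI.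
have {}h0 : e1 \o2 w = 0 by apply: tauI; rewrite h0 tau0.
have h3 : exch23 (w \o1 e1) = - tau (tau (w \o1 e1)) by rewrite h1.
(* [w \o2 -] is reached from [opp2 w \o1 -], where [opp2 w = - w]. *)
have h4 : w \o2 e1 = - tau (tau (w \o1 e1)).
  by apply: tauI; rewrite -comp1_opp2l hw !treeE.
have h5 : w \o2 w = - tau (tau (w \o1 w)).
  by apply: tauI; rewrite -comp1_opp2l hw !treeE.
split; rewrite ?op_d_opp2 ?treeE ?(hA, hB, h0, h2, h3, h4, h5) ?treeE ?(hB, h3)
  ?treeE ?opprK ?de // ?opp20 -?hD //.
Qed.

Lemma Trias_structure_of_As (m : P 2 0) :
  As_structure m -> Trias_structure m m 0.
Proof.
by case=> hm dm; split; rewrite ?treeE ?subrr ?op_d0 ?oppr0.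
Qed.

Lemma Amalg_structure_of_Lie (m : P 2 0) :
  Lie_structure m -> Amalg_structure m 0.
Proof.
case=> hm hJ dm; split;
  rewrite ?hm ?treeE ?opprK ?op_d0 ?oppr0 ?subrr //; abelian.
Qed.

Lemma Pasc_structure_of_Com (m : P 2 0) :
  Com_structure m -> Pasc_structure m m 0.
Proof.
case=> hm hA dm.
have ht : tau (m \o1 m) = m \o1 m by rewrite {1}hA -comp1_opp2l hm.
by split; rewrite ?treeE -?hA ?ht ?op_d0 ?oppr0 ?subrr.
Qed.

(** After substitution of the relations of [Trias] the trees cancel in pairs,
    apart from those which contain [r \o1 x] or [l \o2 x] and vanish. *)
Lemma Amalg_structure_of_Trias (l r : P 2 0) (x : P 2 1) :
  Trias_structure l r x -> Amalg_structure (l - opp2 r) (x + opp2 x).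
Proof.
case=> h1 h2 h3 h4 h5 m1 m2 m3 m4 m5 hx dx dr dl; split.
- by rewrite !treeE addrC.
- by rewrite !treeE h2 h3 -h1 -h5 -h4 ?treeE; abelian.
- by rewrite !treeE -m1 -m2 -m3 ?(m4, m5) ?treeE; abelian.
- by rewrite !treeE m4 m5 ?treeE; abelian.
- by rewrite !treeE hx !treeE; abelian.
- by rewrite op_dD op_d_opp2 dx !treeE; abelian.
- by rewrite op_dB op_d_opp2 dl dr /opp2 op_act0 subrr.
Qed.
End Identities.

(** * Universal properties *)

Section FreeLift.
Variables (G : nat -> int -> Type) (Q : symOperad).
Variable g : forall n k, G n k -> Q n k.

Definition sym_free_fun n k (u : sym_free G n k) : Q n k :=
  sym_eval g (@prepr (sym_term_preOperad G) n k u).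

(** Two expressions are identified in the free operad only if their values in
    [Q] coincide, so the value of a representative is well defined. *)
Lemma sym_free_fun_ppi n k (t : sym_term G n k) :
  sym_free_fun (@ppi (sym_term_preOperad G) n k t) = sym_eval g t.
Proof. exact: (@prepr_pi (sym_term_preOperad G) n k t Q g). Qed.

Lemma sym_freeP n k (u : sym_free G n k) :
  exists t, u = sym_eval (@sym_free_gen G) t.
Proof. by have [t ->] := pqP u; exists t; rewrite sym_free_evalE. Qed.

Lemma sym_free_funE n k (t : sym_term G n k) :
  sym_free_fun (sym_eval (@sym_free_gen G) t) = sym_eval g t.
Proof. by rewrite sym_free_evalE sym_free_fun_ppi. Qed.

Definition sym_free_lift : symMorphism (sym_free G) Q.
Proof.
unshelve eexists; first exists sym_free_fun.
- move=> n k u v; case: (sym_freeP u) (sym_freeP v) => [t ->] [t' ->].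
  by rewrite -[LHS]/(sym_free_fun (sym_eval _ (SymAdd t t'))) !sym_free_funE.
- exact: (sym_free_funE SymId).
- move=> m n p k l s e f i u v.
  case: (sym_freeP u) (sym_freeP v) => [t ->] [t' ->].
  by rewrite -[LHS]/(sym_free_fun (sym_eval _ (SymComp e f i t t')))
    !sym_free_funE.
- move=> n k u; case: (sym_freeP u) => [t ->].
  by rewrite -[LHS]/(sym_free_fun (sym_eval _ (SymD t))) !sym_free_funE.
- move=> n k s u; case: (sym_freeP u) => [t ->] /=.
  by rewrite -[LHS]/(sym_free_fun (sym_eval _ (SymAct s t))) !sym_free_funE.
Defined.

Lemma sym_free_lift_gen n k (x : G n k) :
  sym_free_lift n k (sym_free_gen x) = g x.
Proof. exact: (sym_free_funE (SymGen x)). Qed.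

End FreeLift.

Section NsFreeLift.
Variables (G : nat -> int -> Type) (Q : nsOperad).
Variable g : forall n k, G n k -> Q n k.

Definition ns_free_fun n k (u : ns_free G n k) : Q n k :=
  ns_eval g (@prepr (ns_term_preOperad G) n k u).

Lemma ns_free_fun_ppi n k (t : ns_term G n k) :
  ns_free_fun (@ppi (ns_term_preOperad G) n k t) = ns_eval g t.
Proof. exact: (@prepr_pi (ns_term_preOperad G) n k t Q g). Qed.

Lemma ns_freeP n k (u : ns_free G n k) :
  exists t, u = ns_eval (@ns_free_gen G) t.
Proof. by have [t ->] := pqP u; exists t; rewrite ns_free_evalE. Qed.

Lemma ns_free_funE n k (t : ns_term G n k) :
  ns_free_fun (ns_eval (@ns_free_gen G) t) = ns_eval g t.
Proof. by rewrite ns_free_evalE ns_free_fun_ppi. Qed.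

Definition ns_free_lift : nsMorphism (ns_free G) Q.
Proof.
exists ns_free_fun.
- move=> n k u v; case: (ns_freeP u) (ns_freeP v) => [t ->] [t' ->].
  by rewrite -[LHS]/(ns_free_fun (ns_eval _ (NsAdd t t'))) !ns_free_funE.
- exact: (ns_free_funE NsId).
- move=> m n p k l s e f i u v.
  case: (ns_freeP u) (ns_freeP v) => [t ->] [t' ->].
  by rewrite -[LHS]/(ns_free_fun (ns_eval _ (NsComp e f i t t')))
    !ns_free_funE.
- move=> n k u; case: (ns_freeP u) => [t ->].
  by rewrite -[LHS]/(ns_free_fun (ns_eval _ (NsD t))) !ns_free_funE.
Defined.

Lemma ns_free_lift_gen n k (x : G n k) :
  ns_free_lift n k (ns_free_gen x) = g x.
Proof. exact: (ns_free_funE (NsGen x)). Qed.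

End NsFreeLift.

Lemma ns_kernel_ideal (P Q : nsOperad) (f : nsMorphism P Q) :
  ns_ideal (fun n k (x : P n k) => f n k x = 0).
Proof.
split=> [n k|n k x y hx hy|m n p k l s e h i x y hx|
         m n p k l s e h i x y hy|n k x hx].
- exact: mor0.
- by rewrite morB hx hy subrr.
- by rewrite mor_comp hx op_comp0l.
- by rewrite mor_comp hy op_comp0r.
- by rewrite mor_d hx op_d0.
Qed.

Lemma sym_kernel_ideal (P Q : symOperad) (f : symMorphism P Q) :
  sym_ideal (fun n k (x : P n k) => f n k x = 0).
Proof.
by split=> [|n k s x hx]; [exact: ns_kernel_ideal|rewrite mor_act hx op_act0].
Qed.

Section NsQuotientLift.
Variables (P Q : nsOperad) (I : forall n k, P n k -> Prop).
Variables (HI : ns_ideal I) (f : nsMorphism P Q).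
Hypothesis fI : forall n k (x : P n k), I x -> f n k x = 0.

Definition ns_quot_fun n k (u : ns_quot HI n k) : Q n k :=
  f n k (@prepr (ideal_preOperad HI) n k u).

Lemma ns_quot_fun_proj n k (x : P n k) :
  ns_quot_fun (ns_proj HI n k x) = f n k x.
Proof.
apply/eqP; rewrite -subr_eq0 -morB; apply/eqP/fI.
exact: (@prepr_pi (ideal_preOperad HI)).
Qed.

Definition ns_quot_lift : nsMorphism (ns_quot HI) Q.
Proof.
exists ns_quot_fun.
- move=> n k u v; case: (ns_projP u) (ns_projP v) => [x ->] [y ->].
  by rewrite -morD !ns_quot_fun_proj morD.
- by rewrite -(mor_id (ns_proj HI)) ns_quot_fun_proj mor_id.
- move=> m n p k l s e g i u v.
  case: (ns_projP u) (ns_projP v) => [x ->] [y ->].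
  by rewrite -mor_comp !ns_quot_fun_proj mor_comp.
- move=> n k u; case: (ns_projP u) => [x ->].
  by rewrite -mor_d !ns_quot_fun_proj mor_d.
Defined.

End NsQuotientLift.

(** The kernel of the extension of [g] to the free operad is an ideal, so it
    contains the ideal generated by the relations. *)
Lemma sym_pres_universal (G : nat -> int -> Type) (Q : symOperad)
    (R : forall n k, sym_free G n k -> sym_free G n k -> Prop)
    (g : forall n k, G n k -> Q n k) :
  (forall n k x y, R n k x y ->
     sym_free_lift g n k x = sym_free_lift g n k y) ->
  exists f : symMorphism (sym_pres R) Q,
    forall n k (x : G n k), f n k (sym_gen R x) = g n k x.
Proof.
move=> Rg; have ker n k (x : sym_free G n k) :
    sym_ideal_gen R x -> sym_free_lift g n k x = 0.
  move=> Rx; apply: (Rx _ (sym_kernel_ideal (sym_free_lift g))).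
  by move=> ? ? y z /Rg yz; rewrite morB yz subrr.
exists (sym_lift (sym_ideal_genP R) ker) => n k x.
by rewrite sym_lift_proj sym_free_lift_gen.
Qed.

Lemma ns_pres_universal (G : nat -> int -> Type) (Q : nsOperad)
    (R : forall n k, ns_free G n k -> ns_free G n k -> Prop)
    (g : forall n k, G n k -> Q n k) :
  (forall n k x y, R n k x y ->
     ns_free_lift g n k x = ns_free_lift g n k y) ->
  exists f : nsMorphism (ns_pres R) Q,
    forall n k (x : G n k), f n k (ns_gen R x) = g n k x.
Proof.
move=> Rg; have ker n k (x : ns_free G n k) :
    ns_ideal_gen R x -> ns_free_lift g n k x = 0.
  move=> Rx; apply: (Rx _ (ns_kernel_ideal (ns_free_lift g))).
  by move=> ? ? y z /Rg yz; rewrite morB yz subrr.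
exists (ns_quot_lift (ns_ideal_genP R) ker) => n k x.
exact: etrans (ns_quot_fun_proj _ ker _) (ns_free_lift_gen _ _).
Qed.

Definition symmetrization_mor (P : nsOperad) : nsMorphism P (symmetrization P).
Proof.
exists (@symmetrization_unit P).
- by move=> n k x y; rewrite -[RHS]morD; apply: sym_pres_rel; constructor.
- rewrite -[RHS](mor_id (sym_proj (sym_ideal_genP (@symmetrization_rel P)))).
  by apply: sym_pres_rel; constructor.
- move=> m n p k l s e f i x y; rewrite -[RHS]mor_comp.
  by apply: sym_pres_rel; constructor.
- by move=> n k x; exact: symmetrization_d.
Defined.

Lemma symmetrization_universal (P : nsOperad) (Q : symOperad)
    (f : nsMorphism P Q) :
  exists h : symMorphism (symmetrization P) Q,
    forall n k (x : P n k), h n k (symmetrization_unit x) = f n k x.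
Proof.
apply: sym_pres_universal => _ _ _ _ [n k x y||m n p k l s e h j x y|n k x].
- by rewrite morD !sym_free_lift_gen morD.
- by rewrite sym_free_lift_gen !mor_id.
- by rewrite mor_comp !sym_free_lift_gen mor_comp.
- by rewrite mor_d !sym_free_lift_gen mor_d.
Qed.

Lemma symmetrized_pres_universal (G : nat -> int -> Type) (Q : symOperad)
    (R : forall n k, ns_free G n k -> ns_free G n k -> Prop)
    (g : forall n k, G n k -> Q n k) :
  (forall n k x y, R n k x y ->
     ns_free_lift g n k x = ns_free_lift g n k y) ->
  exists f : symMorphism (symmetrization (ns_pres R)) Q,
    forall n k (x : G n k), f n k (symmetrization_unit (ns_gen R x)) = g n k x.
Proof.
move=> /ns_pres_universal [f fg].
by have [h hf] := symmetrization_universal f; exists h => n k x; rewrite hf.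
Qed.

Lemma sym_eval_eq (G : nat -> int -> Type) (P : symOperad)
    (g g' : forall n k, G n k -> P n k) :
  (forall n k x, g n k x = g' n k x) ->
  forall n k (t : sym_term G n k), sym_eval g t = sym_eval g' t.
Proof.
move=> gg' n k t.
elim: n k / t => [n k x|n k|n k t IH|n k t IHt u IHu||
    m n p k l s e h i t IHt u IHu|n k t IH|n k s t IH] //=;
  by rewrite ?IH ?IHt ?IHu.
Qed.

Lemma ns_eval_eq (G : nat -> int -> Type) (P : nsOperad)
    (g g' : forall n k, G n k -> P n k) :
  (forall n k x, g n k x = g' n k x) ->
  forall n k (t : ns_term G n k), ns_eval g t = ns_eval g' t.
Proof.
move=> gg' n k t.
elim: n k / t => [n k x|n k|n k t IH|n k t IHt u IHu||
    m n p k l s e h i t IHt u IHu|n k t IH] //=;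
  by rewrite ?IH ?IHt ?IHu.
Qed.

Lemma sym_pres_ext (G : nat -> int -> Type) (Q : symOperad)
    (R : forall n k, sym_free G n k -> sym_free G n k -> Prop)
    (f f' : symMorphism (sym_pres R) Q) :
  (forall n k (x : G n k), f n k (sym_gen R x) = f' n k (sym_gen R x)) ->
  eq_mor f f'.
Proof.
move=> ff' n k u; have [t ->] := sym_presP u.
by rewrite !sym_eval_mor; apply: sym_eval_eq.
Qed.

(** Composition of morphisms which need not be equivariant. *)
Definition ns_mor_comp (P Q R : nsOperad) (g : nsMorphism Q R)
  (f : nsMorphism P Q) : nsMorphism P R.
Proof.
exists (fun n k (x : P n k) => g n k (f n k x)).
- by move=> *; rewrite !morD.
- by rewrite !mor_id.
- by move=> *; rewrite !mor_comp.
- by move=> *; rewrite !mor_d.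
Defined.

(** The symmetrization of [P] is generated by [P], itself generated by [G]. *)
Lemma symmetrized_pres_ext (G : nat -> int -> Type) (Q : symOperad)
    (R : forall n k, ns_free G n k -> ns_free G n k -> Prop)
    (f f' : symMorphism (symmetrization (ns_pres R)) Q) :
  (forall n k (x : G n k), f n k (symmetrization_unit (ns_gen R x)) =
     f' n k (symmetrization_unit (ns_gen R x))) ->
  eq_mor f f'.
Proof.
move=> ff'; apply: sym_pres_ext => n k x; have [t ->] := ns_presP x.
pose h (f : symMorphism (symmetrization (ns_pres R)) Q) :=
  ns_mor_comp f (symmetrization_mor (ns_pres R)).
rewrite -[LHS]/(h f n k (ns_eval _ t)) -[RHS]/(h f' n k (ns_eval _ t)).
by rewrite !ns_eval_mor; apply: ns_eval_eq.
Qed.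

(** * The operads of the diagram and their generators *)

(** [mor_d] with the degree of the target in normal form, as it appears in the
    relations on the differential. *)
Lemma mor_d_0 (P Q : nsOperad) (f : nsMorphism P Q) n (x : P n 0) :
  f n (-1) (op_d x) = op_d (f n 0 x).
Proof. exact: (mor_d f x). Qed.

Lemma mor_d_1 (P Q : nsOperad) (f : nsMorphism P Q) n (x : P n 1) :
  f n 0 (op_d x) = op_d (f n 1 x).
Proof. exact: (mor_d f x). Qed.

Definition morE := (mor_comp, mor_d_0, mor_d_1, mor_d, morB, morN, morD, mor0).

Local Transparent tau exch23 comp1 comp2.

(* The compositions are unfolded because their degrees, such as [0 - 1] and
   [-1 + 0], would otherwise have to agree syntactically in both sides. *)
Ltac push_morphism :=
  rewrite /opp2 /tau /exch23 /comp1 /comp2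
    ?(morE, mor_act, sym_free_lift_gen, ns_free_lift_gen).

Ltac sym_relation c := have := sym_pres_rel c; push_morphism; exact.

(** A non-symmetric presentation is transported to the symmetrization along this
    morphism from the free non-symmetric operad. *)
Definition symmetrized_proj (G : nat -> int -> Type)
    (R : forall n k, ns_free G n k -> ns_free G n k -> Prop) :
    nsMorphism (ns_free G) (symmetrization (ns_pres R)) :=
  ns_mor_comp (symmetrization_mor _) (ns_proj (ns_ideal_genP R)).

Lemma symmetrized_pres_rel (G : nat -> int -> Type)
    (R : forall n k, ns_free G n k -> ns_free G n k -> Prop) n k
    (x y : ns_free G n k) : R n k x y ->
  symmetrized_proj R n k x = symmetrized_proj R n k y.
Proof. by move=> /ns_pres_rel; apply: congr1. Qed.

Ltac ns_relation c := have := symmetrized_pres_rel c; push_morphism; exact.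

Lemma Pi_gen_structure :
  Pi_structure (Pi_gen Pi_tensor) (Pi_gen Pi_wedge).
Proof.
split.
- sym_relation Pi_wedge_anti.
- sym_relation Pi_zinbiel.
- sym_relation Pi_mixed1.
- sym_relation Pi_mixed2.
- sym_relation Pi_wedge_assoc.
- sym_relation Pi_d_tensor.
- sym_relation Pi_d_wedge.
Qed.

Lemma K_gen_structure :
  K_structure (K_gen K_lt) (K_gen K_gt) (K_gen K_bar).
Proof.
split.
- ns_relation K_dend1.
- ns_relation K_dend2.
- ns_relation K_dend3.
- ns_relation K_mixed1.
- ns_relation K_mixed2.
- ns_relation K_mixed3.
- ns_relation K_bar_assoc.
- ns_relation K_d_lt.
- ns_relation K_d_gt.
- ns_relation K_d_bar.
Qed.

Lemma Lambda_gen_structure :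
  Lambda_structure (Lambda_gen Lambda_pre) (Lambda_gen Lambda_bracket).
Proof.
split.
- sym_relation Lambda_bracket_sym.
- sym_relation Lambda_prelie.
- sym_relation Lambda_leibniz.
- sym_relation Lambda_jacobi.
- sym_relation Lambda_d_pre.
- sym_relation Lambda_d_bracket.
Qed.

Lemma Pasc_gen_structure :
  Pasc_structure (Pasc_gen Pasc_e1) (Pasc_gen Pasc_e2) (Pasc_gen Pasc_e12).
Proof.
split.
- sym_relation Pasc_exchange.
- sym_relation Pasc_anti.
- sym_relation Pasc_perm1.
- sym_relation Pasc_perm2.
- sym_relation Pasc_perm3.
- sym_relation Pasc_mixed1.
- sym_relation Pasc_mixed2.
- sym_relation Pasc_mixed3.
- sym_relation Pasc_wedge_assoc.
- sym_relation Pasc_d_e12.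
- sym_relation Pasc_d_e1.
Qed.

Lemma Trias_gen_structure :
  Trias_structure (Trias_gen Trias_left) (Trias_gen Trias_right)
    (Trias_gen Trias_times).
Proof.
split.
- ns_relation Trias_dias1.
- ns_relation Trias_dias2.
- ns_relation Trias_dias3.
- ns_relation Trias_dias4.
- ns_relation Trias_dias5.
- ns_relation Trias_mixed1.
- ns_relation Trias_mixed2.
- ns_relation Trias_mixed3.
- ns_relation Trias_mixed4.
- ns_relation Trias_mixed5.
- ns_relation Trias_times_assoc.
- ns_relation Trias_d_times.
- ns_relation Trias_d_right.
- ns_relation Trias_d_left.
Qed.

Lemma Com_gen_structure :
  Com_structure Com_op.
Proof.
split.
- sym_relation Com_comm.
- sym_relation Com_assoc.
- sym_relation Com_d.
Qed.

Lemma As_gen_structure :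
  As_structure As_op.
Proof.
split.
- sym_relation As_assoc.
- sym_relation As_d.
Qed.

Lemma Lie_gen_structure :
  Lie_structure Lie_op.
Proof.
split.
- sym_relation Lie_anti.
- sym_relation Lie_jacobi.
- sym_relation Lie_d.
Qed.

(** Each [X_universal] below is half of the universal property of [X]: elements
    with an [X_structure] are the values of the generators under a morphism. *)
Definition K_interp (P : symOperad) (l g : P 2 0) (b : P 2 (-1)) n k
    (z : K_sort n k) : P n k :=
  match z with K_lt => l | K_gt => g | K_bar => b end.

Lemma K_universal (Q : symOperad) (l g : Q 2 0) (b : Q 2 (-1)) :
  K_structure l g b ->
  exists f : symMorphism K Q,
    [/\ f 2 0 (K_gen K_lt) = l, f 2 0 (K_gen K_gt) = g &
        f 2 (-1) (K_gen K_bar) = b].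
Proof.
case=> *; have [|f fE] :=
    @symmetrized_pres_universal _ Q K_rel (K_interp l g b).
  by move=> ? ? ? ? []; push_morphism.
by exists f; do ?split; apply: fE.
Qed.

Definition Lambda_interp (P : symOperad) (a : P 2 0) (b : P 2 (-1)) n k
    (z : Lambda_sort n k) : P n k :=
  match z with Lambda_pre => a | Lambda_bracket => b end.

Lemma Lambda_universal (Q : symOperad) (a : Q 2 0) (b : Q 2 (-1)) :
  Lambda_structure a b ->
  exists f : symMorphism Lambda Q,
    f 2 0 (Lambda_gen Lambda_pre) = a /\
    f 2 (-1) (Lambda_gen Lambda_bracket) = b.
Proof.
case=> *; have [|f fE] :=
    @sym_pres_universal _ Q Lambda_rel (Lambda_interp a b).
  by move=> ? ? ? ? []; push_morphism.
by exists f; do ?split; apply: fE.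
Qed.

Definition Pasc_interp (P : symOperad) (e1 e2 : P 2 0) (w : P 2 1) n k
    (z : Pasc_sort n k) : P n k :=
  match z with Pasc_e1 => e1 | Pasc_e2 => e2 | Pasc_e12 => w end.

Lemma Pasc_universal (Q : symOperad) (e1 e2 : Q 2 0) (w : Q 2 1) :
  Pasc_structure e1 e2 w ->
  exists f : symMorphism Pasc Q,
    [/\ f 2 0 (Pasc_gen Pasc_e1) = e1, f 2 0 (Pasc_gen Pasc_e2) = e2 &
        f 2 1 (Pasc_gen Pasc_e12) = w].
Proof.
case=> *; have [|f fE] :=
    @sym_pres_universal _ Q Pasc_rel (Pasc_interp e1 e2 w).
  by move=> ? ? ? ? []; push_morphism.
by exists f; do ?split; apply: fE.
Qed.

Definition Trias_interp (P : symOperad) (l r : P 2 0) (x : P 2 1) n k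
    (z : Trias_sort n k) : P n k :=
  match z with Trias_left => l | Trias_right => r | Trias_times => x end.

Lemma Trias_universal (Q : symOperad) (l r : Q 2 0) (x : Q 2 1) :
  Trias_structure l r x ->
  exists f : symMorphism Trias Q,
    [/\ f 2 0 (Trias_gen Trias_left) = l, f 2 0 (Trias_gen Trias_right) = r &
        f 2 1 (Trias_gen Trias_times) = x].
Proof.
case=> *; have [|f fE] :=
    @symmetrized_pres_universal _ Q Trias_rel (Trias_interp l r x).
  by move=> ? ? ? ? []; push_morphism.
by exists f; do ?split; apply: fE.
Qed.

Definition Amalg_interp (P : symOperad) (a : P 2 0) (b : P 2 1) n k
    (z : Amalg_sort n k) : P n k :=
  match z with Amalg_angle => a | Amalg_bracket => b end.

Lemma Amalg_universal (Q : symOperad) (a : Q 2 0) (b : Q 2 1) :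
  Amalg_structure a b ->
  exists f : symMorphism Amalg Q,
    f 2 0 (Amalg_gen Amalg_angle) = a /\
    f 2 1 (Amalg_gen Amalg_bracket) = b.
Proof.
case=> *; have [|f fE] :=
    @sym_pres_universal _ Q Amalg_rel (Amalg_interp a b).
  by move=> ? ? ? ? []; push_morphism.
by exists f; do ?split; apply: fE.
Qed.

Definition binary_interp (P : symOperad) (m : P 2 0) n k
    (z : binary_sort n k) : P n k :=
  match z with binary_op => m end.

Lemma Com_universal (Q : symOperad) (m : Q 2 0) :
  Com_structure m ->
  exists f : symMorphism Com Q, f 2 0 Com_op = m.
Proof.
case=> *; have [|f fE] :=
    @sym_pres_universal _ Q Com_rel (binary_interp m).
  by move=> ? ? ? ? []; push_morphism.
by exists f; do ?split; apply: fE.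
Qed.

Lemma As_universal (Q : symOperad) (m : Q 2 0) :
  As_structure m ->
  exists f : symMorphism As Q, f 2 0 As_op = m.
Proof.
case=> *; have [|f fE] :=
    @sym_pres_universal _ Q As_rel (binary_interp m).
  by move=> ? ? ? ? []; push_morphism.
by exists f; do ?split; apply: fE.
Qed.

Lemma Lie_universal (Q : symOperad) (m : Q 2 0) :
  Lie_structure m ->
  exists f : symMorphism Lie Q, f 2 0 Lie_op = m.
Proof.
case=> *; have [|f fE] :=
    @sym_pres_universal _ Q Lie_rel (binary_interp m).
  by move=> ? ? ? ? []; push_morphism.
by exists f; do ?split; apply: fE.
Qed.

(** * The diagram *)

Lemma mor_antisymmetrize (P Q : symOperad) (f : symMorphism P Q) k
    (x y : P 2 k) :
  f 2 k (x - opp2 y) = f 2 k x - opp2 (f 2 k y).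
Proof. by rewrite morB mor_opp2. Qed.

Lemma mor_symmetrize (P Q : symOperad) (f : symMorphism P Q) k (x y : P 2 k) :
  f 2 k (x + opp2 y) = f 2 k x + opp2 (f 2 k y).
Proof. by rewrite morD mor_opp2. Qed.

Lemma commutator_sum (P : symOperad) k (l g : P 2 k) :
  l - opp2 g - opp2 (l - opp2 g) = l + g - opp2 (l + g).
Proof. by rewrite !treeE; abelian. Qed.

(* Conversion identifies [Trias] with a symmetrized presentation; it has to
   unfold these names before it looks into the quotients. *)
Local Strategy expand [Trias Trias_ns].

Lemma Trias_ext (Q : symOperad) (f f' : symMorphism Trias Q) :
  f 2 0 (Trias_gen Trias_left) = f' 2 0 (Trias_gen Trias_left) ->
  f 2 0 (Trias_gen Trias_right) = f' 2 0 (Trias_gen Trias_right) ->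
  f 2 1 (Trias_gen Trias_times) = f' 2 1 (Trias_gen Trias_times) ->
  eq_mor f f'.
Proof.
move=> hl hr hx.
have ff' n k (x : Trias_sort n k) : f n k (Trias_gen x) = f' n k (Trias_gen x).
  by case: x.
exact: (@symmetrized_pres_ext _ Q Trias_rel f f' ff').
Qed.

Lemma described_diagram : exists D : diagram, described D.
Proof.
have [k_pi hk] := K_universal (K_structure_of_Pi Pi_gen_structure).
have [la_k hla] := Lambda_universal (Lambda_structure_of_K K_gen_structure).
have [as_com has] := As_universal (As_structure_of_Com Com_gen_structure).
have [lie_as hlie] := Lie_universal (Lie_structure_of_As As_gen_structure).
have [tr_pa htr] :=
  Trias_universal (Trias_structure_of_Pasc Pasc_gen_structure).
have [am_tr ham] :=
  Amalg_universal (Amalg_structure_of_Trias Trias_gen_structure).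
have [com_pi hcom] := Com_universal (Com_structure_of_Pi Pi_gen_structure).
have [as_k hask] := As_universal (As_structure_of_K K_gen_structure).
have [lie_la hliela] :=
  Lie_universal (Lie_structure_of_Lambda Lambda_gen_structure).
have [pa_com hpa] := Pasc_universal (Pasc_structure_of_Com Com_gen_structure).
have [tr_as htras] := Trias_universal (Trias_structure_of_As As_gen_structure).
have [am_lie hamlie] :=
  Amalg_universal (Amalg_structure_of_Lie Lie_gen_structure).
exists (Diagram k_pi la_k as_com lie_as tr_pa am_tr com_pi as_k lie_la pa_com
  tr_as am_lie).
exact: (conj (And5 hk hla (conj has hlie) htr ham)
  (And4 (And3 hcom hask hliela) hpa htras hamlie)).
Qed.

Lemma described_squares_commute (D : diagram) :
  described D -> squares_commute D.
Proof.
case=> [[[kl kg kb] [la lb] [ac li] [tl tr tx] [aa ab]]].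
case=> [[cp ak ll] [p1 p2 p12] [ta1 ta2 ta3] [al1 al2]].
have com : K_Pi D 2 0 (As_K D 2 0 As_op) = Com_Pi D 2 0 (As_Com D 2 0 As_op).
  by rewrite ak ac cp [LHS]morD kl kg.
have lie : Lambda_K D 2 0 (Lie_Lambda D 2 0 Lie_op) =
    As_K D 2 0 (Lie_As D 2 0 Lie_op).
  rewrite ll li [LHS]mor_antisymmetrize [RHS]mor_antisymmetrize la ak.
  exact: commutator_sum.
have left : As_Com D 2 0 (Trias_As D 2 0 (Trias_gen Trias_left)) =
    Pasc_Com D 2 0 (Trias_Pasc D 2 0 (Trias_gen Trias_left)).
  by rewrite ta1 ac tl p1.
have right : As_Com D 2 0 (Trias_As D 2 0 (Trias_gen Trias_right)) =
    Pasc_Com D 2 0 (Trias_Pasc D 2 0 (Trias_gen Trias_right)).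
  by rewrite ta2 ac tr p2.
have times : As_Com D 2 1 (Trias_As D 2 1 (Trias_gen Trias_times)) =
    Pasc_Com D 2 1 (Trias_Pasc D 2 1 (Trias_gen Trias_times)).
  by rewrite ta3 tx p12; exact: mor0.
have angle : Lie_As D 2 0 (Amalg_Lie D 2 0 (Amalg_gen Amalg_angle)) =
    Trias_As D 2 0 (Amalg_Trias D 2 0 (Amalg_gen Amalg_angle)).
  by rewrite al1 li aa [RHS]mor_antisymmetrize ta1 ta2.
have bracket : Lie_As D 2 1 (Amalg_Lie D 2 1 (Amalg_gen Amalg_bracket)) =
    Trias_As D 2 1 (Amalg_Trias D 2 1 (Amalg_gen Amalg_bracket)).
  rewrite al2 ab [RHS]mor_symmetrize ta3 opp20 addr0; exact: mor0.
split; [|split; [|split]].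
- by split=> n k x; exact: sym_lift_proj.
- by split; apply: sym_pres_ext => n k [].
- split; last by apply: sym_pres_ext => n k []; [exact: angle|exact: bracket].
  by apply: Trias_ext; [exact: left|exact: right|exact: times].
- by split.
Qed.

Theorem proposition13 :
  (exists D : diagram, described D) /\
  (forall D : diagram, described D -> squares_commute D).
Proof.
by split; [exact: described_diagram|exact: described_squares_commute].
Qed.
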